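(* Assume that $h(\underline{1})\neq0$ and let $\mathfrak m\in G$. Then: a) $\dim L(\mathfrak m)\le N$. b) If $\dim L(\mathfrak m)=n<N$, then $\mathfrak m\in G_{\frac{i-1}{2}}+\underline{j}$, where $n=2j+i$ with $i\in\{1,2\}$, $j\in\mathbb{Z}_{\ge0}$. c) If $i\in\{1,2\}$, $j\in\mathbb{Z}_{\ge0}$, $2j+i\le N$ and $\mathfrak m\in G_{\frac{i-1}{2}}$, then $\dim L(\mathfrak m+\underline{j})=2j+i$. d) If $N'<\infty$, then $\dim L(\mathfrak m+\underline{N'j})=\dim L(\mathfrak m)$ for any $j\in\mathbb{Z}$.
   Context: Setting. $\mathbb{K}$ is an algebraically closed field of characteristic zero. $R$ is a finitely generated commutative $\mathbb{K}$-algebra, $\sigma$ a $\mathbb{K}$-algebra automorphism of $R$, $h\in R$, $\xi\in\mathbb{K}\setminus\{0\}$. $A=A(R,\sigma,h,\xi)$ is the associative unital algebra obtained from $R$ by adjoining $X_+,X_-$ with relations $X_\pm a=\sigma^{\pm1}(a)X_\pm$ ($a\in R$) and $X_+X_-=h+\xi X_-X_+$. It is assumed that $R$ is a Hopf algebra with structure $(\Delta,\varepsilon,S)$ and that there are $r_\pm,l_\pm,s_\pm\in R$ with: $(\sigma\otimes\mathrm{Id})\Delta=\Delta\sigma=(\mathrm{Id}\otimes\sigma)\Delta$ and $S\sigma=\sigma^{-1}S$ on $R$; $\Delta(h)=h\otimes r_+r_-+l_+l_-\otimes h$, $\varepsilon(h)=0$, $S(h)=-(l_+l_-r_+r_-)^{-1}h$;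 $r_\pm,l_\pm$ grouplike; $\sigma(l_\pm)\otimes\sigma(r_\mp)=\xi\,l_\pm\otimes r_\mp$; $(s_\pm)^{-1}=-l_\pm\sigma^{\pm1}(r_\pm)$. Then $A$ is a Hopf algebra extending $R$ via $\Delta(X_\pm)=X_\pm\otimes r_\pm+l_\pm\otimes X_\pm$, $\varepsilon(X_\pm)=0$, $S(X_\pm)=s_\pm X_\pm$. Group of weights. $G$ is the set of maximal ideals of $R$. For $\mathfrak m\in G$, $a\in R$, $a(\mathfrak m)=\varphi_{\mathfrak m}(a)\in\mathbb{K}$ is the unique scalar with $a-a(\mathfrak m)\in\mathfrak m$. $G$ is a group (written additively, not necessarily abelian) with $\mathfrak m+\mathfrak n=\ker\big(a\mapsto\sum a'(\mathfrak m)a''(\mathfrak n)\big)$ where $\Delta(a)=\sum a'\otimes a''$, unit $\underline{0}=\ker\varepsilon|_R$, inverse $-\mathfrak m=S(\mathfrak m)$. For $n\in\mathbb{Z}$, $\underline{n}=\sigma^n(\underline{0})$. Torsion-freeness is assumed: $\sigma^n(\mathfrak m)\ne\mathfrak m$ for all $n\in\mathbb{Z}\setminus\{0\}$, $\mathfrak m\in G$. Modules. $M(\mathfrak m)=A/(AX_++A\mathfrak m)$ is the Verma module and $L(\mathfrak m)$ its unique simple quotient. Notation. $G_0=\{\mathfrak m\in G: h(\mathfrak m)=0\}$ and $G_{1/2}=\{\mathfrak m\in G: h(\mathfrak m-\underline{1})+\xi h(\mathfrak m)=0\}$; $G_0+\underline{j}=\{\mathfrak m+\underline{j}:\mathfrak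 m\in G_0\}$ and similarly for $G_{1/2}$. Put $r=r_+r_-$ and $r_1=r(\underline{1})$, a nonzero scalar. $N$ is the order of $\xi r_1$ if $(\xi r_1)^2\ne1$ and $\xi r_1$ is a root of unity, and $N=\infty$ otherwise. $N'=N$ if $N$ is (finite and) odd, $N'=N/2$ if $N$ is (finite and) even, $N'=\infty$ if $N=\infty$. *)

(* Defs.v *)
From HB Require Import structures.
From mathcomp Require Import all_boot all_order all_algebra.
From mathcomp Require Import sesquilinear generic_quotient ring_quotient.
From mathcomp Require Import boolp classical_sets.

Set Implicit Arguments.
Unset Strict Implicit.
Unset Printing Implicit Defensive.

Import GRing.Theory.
Local Open Scope ring_scope.
Local Open Scope quotient_scope.
Local Open Scope classical_set_scope.

(* ------------------------------------------------------------------------ *)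
(* Tensor product V (x) W of K-modules: formal finite sums of pairs, two of
   them being identified when no K-bilinear map separates them. *)

Section Tensor.
Variables (K : comNzRingType) (V W : lmodType K).

Definition tsum (U : nmodType) (B : V -> W -> U) (s : seq (V * W)) : U :=
  \sum_(p <- s) B p.1 p.2.

Definition teq (s t : seq (V * W)) : bool :=
  `[< forall (U : lmodType K) (B : {bilinear V -> W -> U}),
        tsum B s = tsum B t >].

Lemma teq_is_equiv : equiv_class_of teq.
Proof.
split=> [s|s t|t s u].
- by apply/asboolP.
- by apply/asboolP/asboolP => e U B; rewrite e.
- by move=> /asboolP e1 /asboolP e2; apply/asboolP => U B; rewrite e1 e2.
Qed.

Canonical teq_equiv := EquivRelPack teq_is_equiv.
Canonical teq_encModRel := defaultEncModRel teq.

Definition tensor := {eq_quot teq}.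
HB.instance Definition _ : EqQuotient (seq (V * W)) teq tensor :=
  EqQuotient.on tensor.
HB.instance Definition _ := Choice.on tensor.

Definition tpi (s : seq (V * W)) : tensor := \pi_tensor s.

Definition tens (v : V) (w : W) : tensor := tpi [:: (v, w)].

(* The map V (x) W -> U induced by B, meaningful when B is bilinear. *)
Definition tlift (U : nmodType) (B : V -> W -> U) (x : tensor) : U :=
  tsum B (repr x).

Lemma tpiP s t : tpi s = tpi t <-> teq s t.
Proof. by split=> [/eqP|e]; [rewrite piE | apply/eqP; rewrite piE]. Qed.

Lemma tpi_repr x : tpi (repr x) = x.
Proof. exact: reprK. Qed.

Lemma tlift_pi (U : lmodType K) (B : V -> W -> U) :
  bilinear_for *:%R *:%R B -> forall s, tlift B (tpi s) = tsum B s.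
Proof.
move=> hB s; pose M := bilinear_isBilinear.Build K V W U *:%R *:%R B hB.
pose B' : {bilinear V -> W -> U} := HB.pack B M.
have /tpiP/asboolP/(_ U B') := tpi_repr (tpi s).
by [].
Qed.

Lemma tpi_eq s t :
  (forall (U : lmodType K) (B : {bilinear V -> W -> U}),
     tsum B s = tsum B t) -> tpi s = tpi t.
Proof. by move=> e; apply/tpiP/asboolP. Qed.

Lemma tsum_tpi_eq (U : lmodType K) (B : {bilinear V -> W -> U}) s t :
  tpi s = tpi t -> tsum B s = tsum B t.
Proof. by move=> /tpiP/asboolP. Qed.

Lemma tsum_cat (U : nmodType) (B : V -> W -> U) s t :
  tsum B (s ++ t) = tsum B s + tsum B t.
Proof. exact: big_cat. Qed.

Definition tscal_seq (k : K) (s : seq (V * W)) := [seq (k *: p.1, p.2) | p <- s].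

Lemma tsum_scal (U : lmodType K) (B : {bilinear V -> W -> U}) k s :
  tsum B (tscal_seq k s) = k *: tsum B s.
Proof.
rewrite /tsum big_map scaler_sumr; apply: eq_bigr => p _ /=.
by rewrite linearZl_LR.
Qed.

Definition tadd (x y : tensor) := tpi (repr x ++ repr y).
Definition tscale (k : K) (x : tensor) := tpi (tscal_seq k (repr x)).
Definition topp (x : tensor) := tscale (-1) x.
Definition tzero : tensor := tpi [::].

Lemma tsum_repr (U : lmodType K) (B : {bilinear V -> W -> U}) s :
  tsum B (repr (tpi s)) = tsum B s.
Proof. by apply: tsum_tpi_eq; rewrite tpi_repr. Qed.

Lemma tensor_eqP (x y : tensor) :
  (forall (U : lmodType K) (B : {bilinear V -> W -> U}),
     tsum B (repr x) = tsum B (repr y)) -> x = y.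
Proof. by rewrite -{2}[x]tpi_repr -{2}[y]tpi_repr; exact: tpi_eq. Qed.

Lemma taddA : associative tadd.
Proof.
by move=> x y z; apply: tensor_eqP => U B;
  rewrite !(tsum_repr, tsum_cat) addrA.
Qed.

Lemma taddC : commutative tadd.
Proof.
by move=> x y; apply: tensor_eqP => U B;
  rewrite !(tsum_repr, tsum_cat) addrC.
Qed.

Lemma tadd0 : left_id tzero tadd.
Proof.
by move=> x; apply: tensor_eqP => U B;
  rewrite !(tsum_repr, tsum_cat) /tsum big_nil add0r.
Qed.

Lemma taddN : left_inverse tzero topp tadd.
Proof.
move=> x; apply: tensor_eqP => U B.
by rewrite !(tsum_repr, tsum_cat, tsum_scal) scaleN1r addNr /tsum big_nil.
Qed.

HB.instance Definition _ :=
  GRing.isZmodule.Build tensor taddA taddC tadd0 taddN.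

Lemma tscaleA a b x : tscale a (tscale b x) = tscale (a * b) x.
Proof.
by apply: tensor_eqP => U B; rewrite !(tsum_repr, tsum_scal) scalerA.
Qed.

Lemma tscale1 : left_id 1 tscale.
Proof.
by move=> x; apply: tensor_eqP => U B; rewrite !(tsum_repr, tsum_scal) scale1r.
Qed.

Lemma tscaleDr : right_distributive tscale +%R.
Proof.
move=> a x y; apply: tensor_eqP => U B.
by rewrite !(tsum_repr, tsum_scal, tsum_cat) scalerDr.
Qed.

Lemma tscaleDl x : {morph tscale^~ x : a b / a + b}.
Proof.
move=> a b; apply: tensor_eqP => U B.
by rewrite !(tsum_repr, tsum_scal, tsum_cat) scalerDl.
Qed.

HB.instance Definition _ :=
  GRing.Zmodule_isLmodule.Build K tensor tscaleA tscale1 tscaleDr tscaleDl.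

Lemma tsum_bilinear_linear (U : lmodType K) (B : V -> W -> U) :
  bilinear_for *:%R *:%R B -> linear (tlift B).
Proof.
move=> hB k x y; pose M := bilinear_isBilinear.Build K V W U *:%R *:%R B hB.
pose B' : {bilinear V -> W -> U} := HB.pack B M.
by rewrite /tlift -[B]/(B' : V -> W -> U) !(tsum_repr, tsum_cat, tsum_scal).
Qed.

Lemma tlift_tens (U : lmodType K) (B : V -> W -> U) :
  bilinear_for *:%R *:%R B -> forall v w, tlift B (tens v w) = B v w.
Proof. by move=> hB v w; rewrite tlift_pi // /tsum big_seq1. Qed.

Lemma tens_bilinear : bilinear_for *:%R *:%R tens.
Proof.
split=> [w|v] k a b; apply: tensor_eqP => U B;
  rewrite !(tsum_repr, tsum_cat, tsum_scal) /tsum !big_seq1 /=.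
- by rewrite linearPl.
- by rewrite linearPr.
Qed.

Lemma tensE (x : tensor) : x = tsum tens (repr x).
Proof.
rewrite -{1}[x]tpi_repr; elim: (repr x) => [|p s IH]; first by rewrite /tsum big_nil.
rewrite /tsum big_cons -[X in _ = _ + X]/(tsum tens s) -IH.
apply: tensor_eqP => U B; rewrite !(tsum_repr, tsum_cat).
by rewrite /tsum big_cons big_seq1.
Qed.

End Tensor.

Notation "V ⊗ W" := (tensor V W) (at level 40, left associativity) : type_scope.

Section TensorMaps.
Variable K : comNzRingType.

Definition tmap (V W V' W' : lmodType K) (f : V -> V') (g : W -> W') :
    V ⊗ W -> V' ⊗ W' :=
  tlift (fun v w => tens (f v) (g w)).

Definition tassoc (U V W : lmodType K) : (U ⊗ V) ⊗ W -> U ⊗ (V ⊗ W) :=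
  tlift (fun x w => tlift (fun u v => tens u (tens v w)) x).

End TensorMaps.

(* ------------------------------------------------------------------------ *)
(* The algebra R (x) S, with (a (x) b)(c (x) d) = ac (x) bd. *)

Section TensorRing.
Variables (K : comNzRingType) (R S : comAlgType K).

Definition tmul_seq (s t : seq (R * S)) :=
  [seq (p.1 * q.1, p.2 * q.2) | p <- s, q <- t].

Definition tmul (x y : R ⊗ S) : R ⊗ S := tpi (tmul_seq (repr x) (repr y)).

Lemma tsum_mul (U : nmodType) (B : R -> S -> U) s t :
  tsum B (tmul_seq s t) =
  tsum (fun a b => tsum (fun c d => B (a * c) (b * d)) t) s.
Proof. by rewrite /tsum /tmul_seq big_allpairs_dep. Qed.

Lemma tsum_mulC (U : nmodType) (B : R -> S -> U) s t :
  tsum B (tmul_seq s t) = tsum B (tmul_seq t s).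
Proof.
rewrite !tsum_mul /tsum exchange_big /=; apply: eq_bigr => q _.
by apply: eq_bigr => p _; rewrite mulrC [p.2 * _]mulrC.
Qed.

Lemma tmul_bilinear (U : lmodType K) (B : {bilinear R -> S -> U}) c d :
  bilinear_for *:%R *:%R (fun a b => B (a * c) (b * d)).
Proof.
split=> [b|a] k x y /=; rewrite mulrDl -scalerAl; [exact: linearPl|exact: linearPr].
Qed.

Lemma tsum_sum (U : nmodType) (V W : lmodType K) (T : Type)
    (F : T -> V -> W -> U) (t : seq T) (s : seq (V * W)) :
  tsum (fun a b => \sum_(q <- t) F q a b) s = \sum_(q <- t) tsum (F q) s.
Proof. by rewrite /tsum exchange_big. Qed.

Lemma tsum_mull (U : lmodType K) (B : {bilinear R -> S -> U}) s s' t :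
  tpi s = tpi s' -> tsum B (tmul_seq s t) = tsum B (tmul_seq s' t).
Proof.
move=> e; rewrite !tsum_mul /= !(tsum_sum (fun q a b => B (a * q.1) (b * q.2))).
apply: eq_bigr => q _; have hB := tmul_bilinear B q.1 q.2.
by rewrite -!(tlift_pi hB) e.
Qed.

Lemma tsum_repr_mul (U : lmodType K) (B : {bilinear R -> S -> U}) s t :
  tsum B (tmul_seq (repr (tpi s)) (repr (tpi t))) = tsum B (tmul_seq s t).
Proof.
rewrite (tsum_mull _ _ (tpi_repr (tpi s))) tsum_mulC.
by rewrite (tsum_mull _ _ (tpi_repr (tpi t))) tsum_mulC.
Qed.

Lemma tsum_repr_mull (U : lmodType K) (B : {bilinear R -> S -> U}) s t :
  tsum B (tmul_seq (repr (tpi s)) t) = tsum B (tmul_seq s t).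
Proof. by rewrite (tsum_mull _ _ (tpi_repr (tpi s))). Qed.

Lemma tsum_repr_mulr (U : lmodType K) (B : {bilinear R -> S -> U}) s t :
  tsum B (tmul_seq s (repr (tpi t))) = tsum B (tmul_seq s t).
Proof. by rewrite tsum_mulC tsum_repr_mull tsum_mulC. Qed.

Lemma tmulA : associative tmul.
Proof.
move=> x y z; apply: tensor_eqP => U B.
rewrite !(tsum_repr, tsum_repr_mull, tsum_repr_mulr) tsum_mul.
rewrite [RHS]tsum_mul [RHS]tsum_mul.
apply: eq_bigr => p _; rewrite tsum_mul.
by do 2![apply: eq_bigr => ? _]; rewrite !mulrA.
Qed.

Lemma tmulC : commutative tmul.
Proof.
by move=> x y; apply: tensor_eqP => U B; rewrite !tsum_repr tsum_mulC.
Qed.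

Lemma tmul1 : left_id (tens 1 1) tmul.
Proof.
move=> x; apply: tensor_eqP => U B; rewrite !tsum_repr tsum_repr_mull.
rewrite tsum_mul /tsum big_seq1 /=.
by apply: eq_bigr => p _; rewrite !mul1r.
Qed.

Lemma tmulDl : left_distributive tmul +%R.
Proof.
move=> x y z; apply: tensor_eqP => U B.
by rewrite !(tsum_repr, tsum_cat, tsum_repr_mull) !tsum_mul tsum_cat.
Qed.

HB.instance Definition _ :=
  GRing.Zmodule_isComPzRing.Build (R ⊗ S) tmulA tmulC tmul1 tmulDl.

Lemma tens_mul (a c : R) (b d : S) : tens a b * tens c d = tens (a * c) (b * d).
Proof.
apply: tensor_eqP => U B; rewrite !tsum_repr tsum_repr_mul.
by rewrite tsum_mul /tsum !big_seq1.
Qed.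

End TensorRing.

(* ------------------------------------------------------------------------ *)

Section HopfAlgebra.
Variables (K : comNzRingType) (R : comAlgType K).

Record hopf_algebra := HopfAlgebra {
  comult : {linear R -> R ⊗ R};
  counit : {lrmorphism R -> K^o};
  antipode : {linear R -> R};
  comult_morph : monoid_morphism comult;
  coassoc : forall a : R,
    tassoc (tmap comult idfun (comult a)) = tmap idfun comult (comult a);
  counitl : forall a : R,
    tlift (fun x y : R => (counit x : K) *: y) (comult a) = a;
  counitr : forall a : R,
    tlift (fun x y : R => (counit y : K) *: x) (comult a) = a;
  antipodel : forall a : R,
    tlift (fun x y : R => antipode x * y) (comult a) = (counit a : K)%:A;
  antipoder : forall a : R,
    tlift (fun x y : R => x * antipode y) (comult a) = (counit a : K)%:A
}.

Definition grouplike (H : hopf_algebra) (g : R) : Prop :=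
  comult H g = tens g g /\ counit H g = 1.

Definition finitely_generated : Prop :=
  exists s : seq R, forall S : {pred R},
    GRing.subalg_closed S -> {subset s <= S} -> forall a, a \in S.

End HopfAlgebra.

(* ------------------------------------------------------------------------ *)
(* The algebra A(R, sigma, h, xi), through the universal property of its
   presentation. [sigmaV] stands for the inverse of [sigma]. *)

Section Ambiskew.
Variables (K : comNzRingType) (R : comAlgType K).
Variables (sigma sigmaV : R -> R) (h : R) (xi : K).

Record ambiskew_rel (B : algType K) (f : R -> B) (Yp Ym : B) : Prop := {
  rel_plus : forall a, Yp * f a = f (sigma a) * Yp;
  rel_minus : forall a, Ym * f a = f (sigmaV a) * Ym;
  rel_pm : Yp * Ym = f h + xi *: (Ym * Yp)
}.

Record is_ambiskew (A : algType K) (iota : {lrmorphism R -> A}) (Xp Xm : A) :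
    Prop := {
  ambiskew_rels : ambiskew_rel iota Xp Xm;
  ambiskew_ex : forall (B : algType K) (f : {lrmorphism R -> B}) (Yp Ym : B),
    ambiskew_rel f Yp Ym ->
    exists g : {lrmorphism A -> B},
      [/\ forall a, g (iota a) = f a, g Xp = Yp & g Xm = Ym];
  ambiskew_uniq : forall (B : algType K) (g g' : {lrmorphism A -> B}),
    (forall a, g (iota a) = g' (iota a)) -> g Xp = g' Xp -> g Xm = g' Xm ->
    g =1 g'
}.

End Ambiskew.

(* The conditions on (R, sigma, h, xi) and r_+-, l_+-, s_+- under which A
   extends R as a Hopf algebra. Inverses in R are written out: u * x = 1 for
   x^-1 = u. *)
Record hopf_conditions (K : comNzRingType) (R : comAlgType K)
    (H : hopf_algebra R) (sigma sigmaV : R -> R) (h : R) (xi : K)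
    (rp rm lp lm sp sm : R) : Prop := {
  sigma_comultl : forall a,
    tmap sigma idfun (comult H a) = comult H (sigma a);
  sigma_comultr : forall a,
    tmap idfun sigma (comult H a) = comult H (sigma a);
  sigma_antipode : forall a, antipode H (sigma a) = sigmaV (antipode H a);
  comult_h : comult H h = tens h (rp * rm) + tens (lp * lm) h;
  counit_h : counit H h = 0;
  antipode_h : exists2 u, u * (lp * lm * rp * rm) = 1 & antipode H h = - (u * h);
  grouplike_rp : grouplike H rp;
  grouplike_rm : grouplike H rm;
  grouplike_lp : grouplike H lp;
  grouplike_lm : grouplike H lm;
  sigma_lp_rm : tens (sigma lp) (sigma rm) = xi *: tens lp rm;
  sigma_lm_rp : tens (sigma lm) (sigma rp) = xi *: tens lm rp;
  inv_sp : - (lp * sigma rp) * sp = 1;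
  inv_sm : - (lm * sigmaV rm) * sm = 1
}.

(* ------------------------------------------------------------------------ *)
(* The elements of G are maximal ideals, kept as subsets of R: the operations
   below make sense on all subsets, and are the group operations on the maximal
   ideals. *)

Section Weights.
Variables (K : fieldType) (R : comAlgType K).

(* [idealr_closed] only holds of proper ideals. *)
Definition maximal_ideal (m : set R) : Prop :=
  idealr_closed [in m] /\
  forall J : set R, idealr_closed [in J] -> m `<=` J -> J = m.

(* a(m), the scalar such that a - a(m) belongs to m. *)
Definition ev (m : set R) (a : R) : K :=
  xget 0 [set c : K | m (a - c%:A)].

Definition zpow (sigma sigmaV : R -> R) (n : int) : R -> R :=
  match n with
  | Posz n => iter n sigma
  | Negz n => iter n.+1 sigmaV
  end.

Variable H : hopf_algebra R.

Definition wadd (m n : set R) : set R :=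
  [set a | tlift (fun x y => ev m x * ev n y) (comult H a) = 0].

Definition wopp (m : set R) : set R := antipode H @` m.

Definition wzero : set R := [set a | counit H a = 0].

Definition wint (sigma sigmaV : R -> R) (n : int) : set R :=
  zpow sigma sigmaV n @` wzero.

(* G_0 for k = 0, G_{1/2} for k = 1 *)
Definition Ghalf (sigma sigmaV : R -> R) (h : R) (xi : K) (k : nat) :
    set (set R) :=
  [set m | maximal_ideal m /\
    if k is 0 then ev m h = 0
    else ev (wadd m (wopp (wint sigma sigmaV 1))) h + xi * ev m h = 0].

Definition Gshift (G : set (set R)) (n : set R) : set (set R) :=
  [set wadd m n | m in G].

Definition torsion_free (sigma sigmaV : R -> R) : Prop :=
  forall (n : int) (m : set R), n != 0 -> maximal_ideal m ->
    zpow sigma sigmaV n @` m <> m.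

End Weights.

(* ------------------------------------------------------------------------ *)

Section QuotientModule.
Variables (A : pzRingType) (M : lmodType A) (N : {pred M}).
Hypothesis hN : GRing.submod_closed N.

Definition qpred of GRing.submod_closed N : M -> bool := fun x => x \in N.

Lemma qpred_zmod : zmod_closed (qpred hN).
Proof. exact: GRing.submod_closedB hN. Qed.

HB.instance Definition _ := GRing.isZmodClosed.Build M (qpred hN) qpred_zmod.

Definition quotmod := 
  Quotient.quot (GRing.ZmodClosed.clone M (qpred hN) _).
HB.instance Definition _ := GRing.Zmodule.on quotmod.
HB.instance Definition _ := EqQuotient.on quotmod.

Definition qscale (a : A) (x : quotmod) : quotmod :=
  \pi_quotmod (a *: repr x).

Lemma qpi_eq (x y : M) :
  \pi_quotmod x = \pi_quotmod y <-> x - y \in N.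
Proof.
have e := Quotient.idealrBE (GRing.ZmodClosed.clone M (qpred hN) _) x y.
by rewrite -[x - y \in N]/(x - y \in qpred hN) e; split=> /eqP.
Qed.

Lemma qscale_pi a (x : M) : qscale a (\pi_quotmod x) = \pi_quotmod (a *: x).
Proof.
have [N0 Nl] := hN; apply/qpi_eq; rewrite -scalerBr -[_ *: _]addr0.
by apply: Nl => //; apply/qpi_eq; rewrite reprK.
Qed.

Lemma qaddE (x y : M) : \pi_quotmod x + \pi_quotmod y = \pi_quotmod (x + y).
Proof. by rewrite !piE. Qed.

Lemma qscaleA a b x : qscale a (qscale b x) = qscale (a * b) x.
Proof. by rewrite -[x]reprK !qscale_pi scalerA reprK. Qed.

Lemma qscale1 : left_id 1 qscale.
Proof. by move=> x; rewrite -[x]reprK qscale_pi scale1r. Qed.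

Lemma qscaleDr : right_distributive qscale +%R.
Proof.
move=> a x y; rewrite -[x]reprK -[y]reprK qaddE !qscale_pi qaddE.
by rewrite scalerDr.
Qed.

Lemma qscaleDl x : {morph qscale^~ x : a b / a + b}.
Proof.
by move=> a b; rewrite -[x]reprK !qscale_pi qaddE scalerDl.
Qed.

HB.instance Definition _ :=
  GRing.Zmodule_isLmodule.Build A quotmod qscaleA qscale1 qscaleDr qscaleDl.

End QuotientModule.

Section Modules.
Variables (K : fieldType) (R : comAlgType K) (A : algType K).

Section Verma.
Variables (iota : R -> A) (Xp : A) (m : set R).

(* A X_+ + A m *)
Definition verma_ideal (x : A^o) : bool :=
  `[< exists (a : A) (s : seq (A * R)),
        (forall p, p \in s -> m p.2) /\
        x = a * Xp + \sum_(p <- s) p.1 * iota p.2 >].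

Lemma verma_ideal_closed : GRing.submod_closed verma_ideal.
Proof.
split=> [|c x y /asboolP[a [s [ms ->]]] /asboolP[b [t [mt ->]]]]; apply/asboolP.
  by exists 0, [::]; rewrite big_nil mul0r addr0.
exists (c * a + b), ([seq (c * p.1, p.2) | p <- s] ++ t); split.
  move=> p; rewrite mem_cat => /orP[/mapP[q qs ->]|]; [exact: (ms q)|exact: mt].
rewrite big_cat big_map /= mulrDl -mulrA.
rewrite -[c *: _]/(c * _) mulrDr mulr_sumr addrACA.
congr (_ + _); congr (_ + _).
by apply: eq_bigr => p _; rewrite mulrA.
Qed.

Definition verma : lmodType A := quotmod verma_ideal_closed.

End Verma.

Definition simple_module (L : lmodType A) : Prop :=
  (exists v : L, v != 0) /\
  forall S : {pred L}, GRing.submod_closed S ->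
    (forall v, v \in S -> v = 0) \/ (forall v, v \in S).

Definition simple_quotient (M L : lmodType A) : Prop :=
  simple_module L /\ exists pi : {linear M -> L}, forall y, exists x, pi x = y.

(* An A-module is a K-space through k |-> k%:A. *)
Definition has_kdim (L : lmodType A) (n : nat) : Prop :=
  exists b : 'I_n -> L, forall v, exists! c : 'rV[K]_n,
    v = \sum_i (c 0 i)%:A *: b i.

(* None stands for infinity, here and below. *)
Definition kdim (L : lmodType A) : option nat :=
  if `[< exists n, has_kdim L n >] then Some (xget 0%N [set n | has_kdim L n])
  else None.

End Modules.

Definition ole (a b : option nat) : bool :=
  match a, b with
  | _, None => true
  | None, Some _ => false
  | Some p, Some q => (p <= q)%N
  end.

Definition olt (a b : option nat) : bool := ~~ ole b a.

(* N and N' as functions of x = xi r_1 *)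
Definition Nord (K : fieldType) (x : K) : option nat :=
  if (x ^+ 2 != 1) && `[< exists n, n.-primitive_root x >]
  then Some (xget 0%N [set n | n.-primitive_root x]) else None.

Definition Nord' (K : fieldType) (x : K) : option nat :=
  omap (fun n => if odd n then n else n./2) (Nord x).

(* Main.v *)
(* A weight chi is a character of R (Nullstellensatz), and L(chi) is spanned by
   v_k = X_-^k v, of weight chi sigma^k, with X_+ v_k = c_k v_(k-1) where
   c_k = sum_(i<k) xi^(k-1-i) chi(sigma^i h). Torsion-freeness makes these
   weights distinct, so that dim L(chi) is the least k > 0 with c_k = 0; no PBW
   basis of A is needed.

   The formula for Delta(h) gives sigma h = (xi/q) h - xi^2 h(1) l and
   sigma l = xi q l for q = xi r_1 and l = l_+ l_-. Hence
   gam_i = xi^-i chi(sigma^i h) satisfies gam_(i+1) = q^-1 gam_i - beta q^i with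
   beta != 0, and the vanishing of c_n = xi^(n-1) sum_(i<n) gam_i amounts, below
   the order of q, to chi sigma^j being in G_0 or G_(1/2). Part d) holds because
   chi(sigma^N' h) is a nonzero multiple of chi(h), for the same scalar for all
   chi. *)
Require Import Defs.
From HB Require Import structures.
From mathcomp Require Import all_boot all_order all_algebra.
From mathcomp Require Import generic_quotient ring_quotient sesquilinear.
From mathcomp Require Import boolp classical_sets.
From mathcomp Require Import ring.

Set Implicit Arguments.
Unset Strict Implicit.
Unset Printing Implicit Defensive.

Import GRing.Theory.
Local Open Scope ring_scope.
Local Open Scope classical_set_scope.

(** * The weak Nullstellensatz *)

(** With [[n]_q = 1 + q + ... + q^(n-1)], the sums factor as [(1 + q) q^n (gam_0 + ... + gam_n) =
    [n+1]_q ((1 + q) gam_0 - beta q [n]_q)]. The first factor is the one that sees [N]. For [q]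
    other than [-1], the second vanishes exactly when [chi sigma^j] lies in [G_0] (for [n = 2j]) or
    in [G_(1/2)] (for [n = 2j + 1]), and for distinct [n] below [N] these conditions on [gam_0]
    exclude each other, whence c). The obstacle is [q = -1], where the identity reads [0 = 0]. There
    [N] is infinite and [gam_i = (-1)^i (gam_0 + i beta)] gives the sums directly; characteristic
    zero takes over the role of the order of [q], as it also does at [q = 1], where [[n]_q = n]. The
    group law enters through translations by the points [sigma^n(0)]. Since
    [Delta sigma = (Id (x) sigma) Delta], such a translation is the composition of a character with
    [sigma^-n]. *)

Record prime_ideal (B : comNzRingType) (P : B -> Prop) : Prop := PrimeIdeal {
  prime_ideal0 : P 0;
  prime_idealD : forall a b, P a -> P b -> P (a + b);
  prime_idealMl : forall a b, P b -> P (a * b);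
  prime_ideal1 : ~ P 1;
  prime_idealM : forall a b, P (a * b) -> P a \/ P b
}.

Section PrimeIdeal.
Variables (B : comNzRingType) (P : B -> Prop) (hP : prime_ideal P).

Lemma prime_idealN a : P a -> P (- a).
Proof. by rewrite -mulN1r; exact: prime_idealMl. Qed.

Lemma prime_idealDl a b : P a -> P (a + b) <-> P b.
Proof.
move=> Pa; split=> [Pab|]; last exact: prime_idealD.
rewrite -[b](addKr a); apply: (prime_idealD hP) => //; exact: prime_idealN.
Qed.

Lemma prime_ideal_sum (I : Type) (r : seq I) (Q : pred I) (F : I -> B) :
  (forall i, Q i -> P (F i)) -> P (\sum_(i <- r | Q i) F i).
Proof.
move=> PF; apply: (big_ind P); [exact: prime_ideal0| |exact: PF].
exact: prime_idealD.
Qed.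

Lemma prime_idealX a n : ~ P a -> ~ P (a ^+ n).
Proof.
move=> nPa; elim: n => [|n IH]; first by rewrite expr0; exact: prime_ideal1.
by rewrite exprS => /(prime_idealM hP)[].
Qed.

End PrimeIdeal.

(** If [p] is not constant, then [p - 1] has a root, where [p] takes the value 1. *)
Lemma closed_field_nonroot (K : closedFieldType) (p : {poly K}) :
  p != 0 -> exists c, p.[c] != 0.
Proof.
move=> p0; have [s1|s1] := eqVneq (size p) 1%N.
  have [c c0 ->] := size_poly1P p (introT eqP s1).
  by exists 0; rewrite hornerC.
have : size (p - 1) != 1%N.
  apply: contra s1 => s1; rewrite eqn_leq size_poly_gt0 p0 andbT.
  rewrite -[p](subrK 1) (leq_trans (size_polyD _ _)) // (eqP s1).
  by rewrite size_poly1.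
case/closed_rootP => c; rewrite rootE !hornerE subr_eq0 => /eqP pc.
by exists c; rewrite pc oner_eq0.
Qed.

(* Specialising a polynomial variable modulo a prime ideal [P] of [A[x]]: a
   morphism [phi : A -> K] killing the trace of [P] on [A], and not killing a
   suitable [a], extends by [x |-> c]. When [x] is algebraic modulo [P], one
   takes for [c] a root of the image of a relation of minimal degree. *)
Section Specialise.
Variables (K : closedFieldType) (A : idomainType) (P : {poly A} -> Prop).
Hypothesis hP : prime_ideal P.

(** The ideal of [{poly A}] generated by the trace of [P] on [A]. The variable is algebraic modulo
    [P] when some element of [P] lies outside it. *)
Definition coef_in (p : {poly A}) : Prop := forall i, P (p`_i)%:P.

Lemma coef_in_ideal p : coef_in p -> P p.
Proof.
move=> Pp; rewrite -[p]coefK poly_def; apply: (prime_ideal_sum hP) => i _.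
by rewrite -mul_polyC mulrC; apply: (prime_idealMl hP); exact: Pp.
Qed.

Lemma coef_inD p q : coef_in p -> coef_in q -> coef_in (p + q).
Proof. by move=> Pp Pq i; rewrite coefD polyCD; apply: (prime_idealD hP). Qed.

Lemma coef_inMl p q : coef_in q -> coef_in (p * q).
Proof.
move=> qP i; rewrite coefM; rewrite rmorph_sum; apply: (prime_ideal_sum hP).
by move=> k _; rewrite rmorphM; apply: (prime_idealMl hP); exact: qP.
Qed.

Lemma coef_inMr p q : coef_in p -> coef_in (p * q).
Proof. by rewrite mulrC; exact: coef_inMl. Qed.

Definition lead_mon (p : {poly A}) := (lead_coef p) *: 'X^((size p).-1).

Lemma size_sub_lead (p : {poly A}) :
  p != 0 -> (size (p - lead_mon p)%R < size p)%N.
Proof.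
move=> p0; rewrite -(prednK (n := size p)) ?size_poly_gt0 // ltnS.
apply/leq_sizeP => j; rewrite leq_eqVlt coefB coefZ coefXn => /predU1P[<-|lj].
  by rewrite eqxx mulr1 subrr.
rewrite gtn_eqF // mulr0 subr0 nth_default //.
by rewrite -(prednK (n := size p)) ?size_poly_gt0.
Qed.

Lemma coef_in_lead p : P (lead_coef p)%:P -> coef_in (lead_mon p).
Proof.
by move=> Pl i; rewrite coefZ mulrC polyCM; apply: (prime_idealMl hP).
Qed.

Definition minimal_relation p : Prop :=
  [/\ P p, ~ P (lead_coef p)%:P &
      forall g, P g -> (size g < size p)%N -> coef_in g].

(** Take an element of [P] of least size outside [coef_in]. Were its leading coefficient in [P],
    removing the leading monomial would give a smaller one. *)
Lemma minimal_relation_exists :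
  (exists2 p, P p & ~ coef_in p) -> exists p, minimal_relation p.
Proof.
pose Q n := `[< exists p : {poly A}, [/\ size p = n, P p & ~ coef_in p] >].
case=> p Pp nPp.
have exQ : exists n, Q n by exists (size p); apply/asboolP; exists p.
case: (ex_minnP exQ) => _ /asboolP[g [<- Pg nPg]] gmin; exists g.
have small f : P f -> (size f < size g)%N -> coef_in f.
  move=> Pf lt; apply: contrapT => nPf; move: lt; rewrite ltnNge gmin //.
  by apply/asboolP; exists f.
split=> // Pl.
have g0 : g != 0.
  by apply/eqP => g0; apply: nPg => i; rewrite g0 coef0; exact: (prime_ideal0 hP).
apply: nPg; rewrite -[g](subrK (lead_mon g)).
apply: (coef_inD _ (coef_in_lead Pl)); apply: small; last exact: size_sub_lead.
by apply: (prime_idealD hP) => //; apply: prime_idealN => //;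
  apply/coef_in_ideal/coef_in_lead.
Qed.

Lemma lead_expZ (p f : {poly A}) k :
  lead_coef p ^+ k *: f = (lead_coef p)%:P ^+ k * f.
Proof. by rewrite -mul_polyC polyC_exp. Qed.

(* [a] plays the role of the resultant of [p] and [f]; it comes from Euclid's
   algorithm. *)
Lemma minimal_relation_coprime p f : minimal_relation p -> ~ P f ->
  exists a g, ~ P a%:P /\ P (g * f - a%:P).
Proof.
move=> [Pp nPl pmin]; have [n] := ubnP (size f).
elim: n f => // n IH f /ltnSE sf nPf.
have p0 : p != 0.
  by apply/eqP => p0; apply: nPl; rewrite p0 lead_coef0; exact: (prime_ideal0 hP).
have f0 : f != 0.
  by apply/eqP => f0; apply: nPf; rewrite f0; exact: (prime_ideal0 hP).
(* If the leading coefficient of [f] is in [P], dropping the leading monomial changes [f] by an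
   element of [P] only. *)
have [Plf|nPlf] := pselect (P (lead_coef f)%:P).
  have Pm := coef_in_ideal (coef_in_lead Plf).
  have [|/(prime_idealD hP)/(_ Pm)|a [g [nPa Pg]]] := IH (f - lead_mon f).
  - exact: leq_trans (size_sub_lead f0) sf.
  - by rewrite subrK.
  exists a, g; split=> //.
  rewrite -[f](subrK (lead_mon f)) mulrDr addrAC; apply: (prime_idealD hP) => //.
  exact: (prime_idealMl hP).
(* When [f] is not shorter than [p], its pseudo-remainder modulo [p] replaces it, since [p] is in
   [P]. *)
have [sfp|spf] := ltnP (size f) (size p); last first.
  have := Pdiv.ComRing.rdivp_eq p f; rewrite lead_expZ => e.
  set r := Pdiv.Ring.rmodp f p in e; set q := Pdiv.Ring.rdivp f p in e.
  set k := Pdiv.Ring.rscalp f p in e.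
  have Pqp : P (q * p) by apply: (prime_idealMl hP).
  have nPr : ~ P r.
    move=> Pr; have := prime_idealD hP Pqp Pr; rewrite -e.
    by case/(prime_idealM hP) => //; exact: (prime_idealX hP).
  have [|a [g [nPa Pg]]] := IH r _ nPr.
    by rewrite (leq_trans _ sf) // (leq_trans _ spf) // Pdiv.Ring.ltn_rmodp.
  exists a, (g * (lead_coef p)%:P ^+ k); split=> //.
  rewrite -mulrA e mulrDr -addrA; apply: (prime_idealD hP) => //.
  exact: (prime_idealMl hP).
have [s1|s1] := leqP (size f) 1.
  have fE := size1_polyC s1; exists f`_0, 1; rewrite mul1r {2}fE subrr.
  by split; [rewrite -fE | exact: (prime_ideal0 hP)].
have := Pdiv.ComRing.rdivp_eq f p; rewrite lead_expZ => e.
have := Pdiv.Ring.ltn_rmodp p f; rewrite f0.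
set r := Pdiv.Ring.rmodp p f in e *; set q := Pdiv.Ring.rdivp p f in e *.
set k := Pdiv.Ring.rscalp p f in e * => sr.
have Plp : P ((lead_coef f)%:P ^+ k * p) by apply: (prime_idealMl hP).
(* The remainder of [p] by [f] cannot lie in [P]: then [q] would too, and both are shorter than [p],
   so that by minimality a power of [lead_coef f] times [p] would have all its coefficients in
   [P]. *)
have [Pr|nPr] := pselect (P r).
  have cr : coef_in r by apply: pmin => //; exact: ltn_trans sr sfp.
  have Pq : P q.
    have : P (q * f).
      apply/(prime_idealDl hP (q * f) Pr); rewrite addrC -e; exact: Plp.
    by case/(prime_idealM hP).
  have sq : (size q < size p)%N.
    have [->|q0] := eqVneq q 0; first by rewrite size_poly0 size_poly_gt0.
    have : (size (q * f)%R <= size p)%N.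
      have -> : q * f = (lead_coef f)%:P ^+ k * p - r by rewrite e addrK.
      rewrite (leq_trans (size_polyD _ _)) // size_polyN geq_max.
      rewrite (ltnW (ltn_trans sr sfp)) andbT -polyC_exp mul_polyC.
      exact: size_scale_leq.
    rewrite size_mul //; apply: leq_trans.
    rewrite -subn1 -addnBA ?(ltnW s1) // -[X in (X < _)%N]addn0 ltn_add2l.
    by rewrite subn_gt0.
  have : coef_in ((lead_coef f)%:P ^+ k * p).
    by rewrite e; apply: coef_inD => //; apply: coef_inMr; exact: pmin.
  move/(_ (size p).-1); rewrite -polyC_exp coefCM polyCM => /(prime_idealM hP)[].
    by rewrite polyC_exp => Plk; case: (prime_idealX hP nPlf Plk).
  by move=> Pl; case: nPl.
have [|a [g [nPa Pg]]] := IH r _ nPr; first exact: leq_trans sr sf.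
(* Modulo [P], [r] is [- q * f] and [g * r] is [a]. *)
exists a, (- (g * q)); split=> //.
have -> : - (g * q) * f - a%:P =
    - (g * ((lead_coef f)%:P ^+ k * p)) + (g * r - a%:P).
  by rewrite e mulrDr opprD mulrA mulNr addrA subrK.
apply: (prime_idealD hP) => //; apply: prime_idealN => //.
exact: (prime_idealMl hP).
Qed.

Lemma specialise f : ~ P f ->
  exists2 a, ~ P a%:P & forall phi : {rmorphism A -> K},
    (forall b, P b%:P -> phi b = 0) -> phi a != 0 ->
    exists2 c, (forall g, P g -> (map_poly phi g).[c] = 0) &
               (map_poly phi f).[c] != 0.
Proof.
move=> nPf.
have phi_coef (phi : {rmorphism A -> K}) : (forall b, P b%:P -> phi b = 0) ->
    forall g, coef_in g -> map_poly phi g = 0.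
  move=> phiP g Pg; apply/polyP => i; rewrite coef_map coef0.
  by apply: phiP; exact: Pg.
have [/minimal_relation_exists[p hp]|no_rel] :=
    pselect (exists2 p, P p & ~ coef_in p); last first.
  have [i nPi] : exists i, ~ P (f`_i)%:P.
    by apply/existsNP => /coef_in_ideal.
  exists f`_i => // phi phiP phii.
  have [|c fc] := @closed_field_nonroot K (map_poly phi f).
    by apply: contraNneq phii => f0; rewrite -coef_map f0 coef0.
  exists c => // g Pg; rewrite phi_coef ?horner0 //.
  by apply: contrapT => ng; apply: no_rel; exists g.
have [a [g [nPa Pg]]] := minimal_relation_coprime hp nPf.
have [Pp nPl pmin] := hp.
(* The factor [lead_coef p] keeps the image of [p] nonconstant, hence with a root [c], and lets
   pseudo-division by [p] show that every element of [P] vanishes at [c]. The factor [a] prevents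
   [f] from vanishing there. *)
exists (lead_coef p * a) => [|phi phiP].
  by rewrite polyCM => /(prime_idealM hP)[].
rewrite rmorphM mulf_eq0 negb_or => /andP[phil phia].
have : size (map_poly phi p) != 1%N.
  rewrite size_map_poly_id0 //; apply/eqP => s1.
  have [c _ pE] := size_poly1P p (introT eqP s1).
  by move: Pp nPl; rewrite pE lead_coefC.
case/closed_rootP => c; rewrite rootE => /eqP pc.
have kill f' : P f' -> (map_poly phi f').[c] = 0.
  move=> Pf'.
  have := Pdiv.ComRing.rdivp_eq p f'; rewrite lead_expZ => e.
  set r := Pdiv.Ring.rmodp f' p in e; set q := Pdiv.Ring.rdivp f' p in e.
  have Pr : coef_in r.
    apply: pmin; last first.
      rewrite Pdiv.Ring.ltn_rmodp; apply/eqP => p0.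
      by apply: nPl; rewrite p0 lead_coef0; exact: (prime_ideal0 hP).
    apply/(prime_idealDl hP r (prime_idealMl hP q Pp)); rewrite -e.
    exact: (prime_idealMl hP).
  move/(congr1 (fun p => (map_poly phi p).[c])): e.
  rewrite rmorphM rmorphXn rmorphD rmorphM /= map_polyC /=.
  rewrite (phi_coef _ _ r) // !hornerE pc mulr0 => /eqP.
  by rewrite mulf_eq0 expf_eq0 (negPf phil) andbF => /eqP.
exists c => //; apply/negP => /eqP fc; case/eqP: phia.
have := kill _ Pg; rewrite rmorphB rmorphM /= map_polyC /= !hornerE fc mulr0.
by rewrite sub0r => /eqP; rewrite oppr_eq0 => /eqP.
Qed.

End Specialise.

Section Nullstellensatz.
Variables (K : closedFieldType) (R : comAlgType K).

Section Tower.
Variables (m : R -> Prop) (hm : prime_ideal m).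

(** The invariant of the induction on the generators of [R]. Besides killing the preimage of [m],
    the point [phi] must avoid a prescribed [b], because extending it to one more variable requires
    some element of [A] not to be killed. *)
Definition enough_points (A : idomainType) (kap : {rmorphism K -> A})
    (j : {rmorphism A -> R}) : Prop :=
  (forall k, j (kap k) = k%:A) /\
  forall b, ~ m (j b) -> exists phi : {rmorphism A -> K},
    [/\ forall k, phi (kap k) = k, forall a, m (j a) -> phi a = 0 & phi b != 0].

Lemma enough_points_poly (A : idomainType) (kap : {rmorphism K -> A})
    (j : {rmorphism A -> R}) (x : R) : enough_points kap j ->
  enough_points (polyC \o kap) (horner_eval x \o map_poly j).
Proof.
move=> [jk hj].
set j' : {rmorphism {poly A} -> R} := horner_eval x \o map_poly j.
have j'C a : j' a%:P = j a by rewrite /j' /= /horner_eval map_polyC hornerC.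
have hP : prime_ideal (fun p => m (j' p)).
  split=> [|a b|a b| |a b]; rewrite ?(rmorph0, rmorph1, rmorphD, rmorphM).
  - exact: (prime_ideal0 hm).
  - exact: (prime_idealD hm).
  - exact: (prime_idealMl hm).
  - exact: (prime_ideal1 hm).
  - exact: (prime_idealM hm).
split=> [k|f nmf]; first by rewrite -[LHS]/(j' (kap k)%:P) j'C jk.
have [a nma ext] := specialise K hP nmf.
have [|phi [phik phim phia]] := hj a; first by rewrite -j'C.
have [|c cm cf] := ext phi _ phia; first by move=> b; rewrite j'C; exact: phim.
exists (horner_eval c \o map_poly phi).
split=> [k|g mg|]; last exact: cf; last exact: cm.
by rewrite /= /horner_eval map_polyC hornerC /= phik.
Qed.

(** [A] is a polynomial ring over [K] with one variable for each element of [s]. Over [K] itself the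
    identity is a suitable point, since the proper ideal [m] contains no nonzero scalar. *)
Lemma enough_points_seq (s : seq R) :
  exists (A : idomainType) (kap : {rmorphism K -> A}) (j : {rmorphism A -> R}),
    enough_points kap j /\ forall x, x \in s -> exists a, j a = x.
Proof.
elim: s => [|x s [A [kap [j [hj js]]]]].
  pose j : {rmorphism K -> R} := in_alg R.
  exists K, idfun, j; split=> //; split=> // b nb; exists idfun; split=> //.
    move=> a mja; apply/eqP; apply: contrapT => /negP a0.
    apply: (prime_ideal1 hm); rewrite -[1]scale1r -(mulVf a0) -scalerA -mulr_algl.
    exact: (prime_idealMl hm).
  apply/eqP => b0; apply: nb; rewrite (b0 : b = 0) rmorph0.
  exact: (prime_ideal0 hm).
do 3!eexists; split; first exact: (enough_points_poly x hj).
move=> y; rewrite inE => /predU1P[->|/js[a <-]].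
  by exists 'X; rewrite /= /horner_eval map_polyX hornerX.
by exists a%:P; rewrite /= /horner_eval map_polyC hornerC.
Qed.

End Tower.

Lemma maximal_idealP (m : set R) : idealr_closed [in m] <->
  [/\ m 0, ~ m 1 & forall a u v, m u -> m v -> m (a * u + v)].
Proof.
split=> [[m0 m1 mD]|[m0 m1 mD]].
  split=> [||a u v mu mv]; first by have := m0; rewrite inE.
    by move=> m1'; case/negP: m1; rewrite inE.
  by have := mD a u v; rewrite !inE; apply.
split=> [||a u v]; first by rewrite inE.
  by apply/negP; rewrite inE.
by rewrite !inE; exact: mD.
Qed.

Definition kernel (chi : R -> K) : set R := [set a | chi a = 0].

Lemma kernelE (chi : R -> K) a : kernel chi a = (chi a = 0).
Proof. by []. Qed.

Lemma kernel_idealr_closed (chi : {lrmorphism R -> K^o}) :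
  idealr_closed [in kernel chi].
Proof.
apply/maximal_idealP; split=> [||a u v]; rewrite !kernelE ?rmorph0 ?rmorph1 //.
  by apply/eqP; exact: oner_neq0.
by rewrite rmorphD rmorphM /= => -> ->; rewrite mulr0 addr0.
Qed.

Lemma character_scalar (chi : {lrmorphism R -> K^o}) (c : K) : chi c%:A = c.
Proof. by rewrite linearZ /= rmorph1 [_ *: _]mulr1. Qed.

Lemma sub_character_in_kernel (chi : {lrmorphism R -> K^o}) a :
  kernel chi (a - (chi a : K)%:A).
Proof. by rewrite kernelE rmorphB /= character_scalar subrr. Qed.

Lemma kernel_maximal (chi : {lrmorphism R -> K^o}) :
  maximal_ideal (kernel chi).
Proof.
split=> [|J /maximal_idealP[J0 J1 JD] sJ]; first exact: kernel_idealr_closed.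
apply/seteqP; split=> // a Ja; rewrite kernelE; apply/eqP/negPn/negP => chia.
apply: J1; rewrite -[1]addr0 -[1]scale1r -(mulVf chia) -scalerA -mulr_algl.
apply: (JD) => //; rewrite -[_%:A](subKr a) -[X in J X]addrC -mulN1r.
by apply: (JD) => //; apply: sJ; exact: sub_character_in_kernel.
Qed.

Lemma ev_kernel (chi : {lrmorphism R -> K^o}) a : ev (kernel chi) a = chi a.
Proof.
rewrite /ev; apply: xget_unique => [|c]; first exact: sub_character_in_kernel.
rewrite /= kernelE rmorphB /= character_scalar => /eqP.
by rewrite subr_eq0 => /eqP.
Qed.

(** A polynomial ring maps onto [R] and has a point killing the preimage of [m]. This point factors
    through [R], whatever section [g] of the surjection is chosen, and the kernel of the resulting
    character contains [m], hence equals it. *)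
Lemma maximal_ideal_character (m : set R) :
  finitely_generated R -> maximal_ideal m ->
  exists chi : {lrmorphism R -> K^o}, m = kernel chi.
Proof.
move=> [s gen] [/maximal_idealP[m0 m1 mD] mmax].
have mA a b : m a -> m b -> m (a + b).
  by move=> ma mb; rewrite -[a]mul1r; exact: mD.
have mM a b : m b -> m (a * b) by move=> mb; rewrite -[a * b]addr0; exact: mD.
have hm : prime_ideal m.
  split=> // a b mab; have [ma|nma] := pselect (m a); [by left | right].
  (* [J] is the ideal [m + a R]: either it contains 1, which puts [b] in [m], or it is proper and
     equals [m], contradicting [nma]. *)
  pose J : set R := [set x | exists c, m (x - a * c)].
  have Jm : m `<=` J by move=> x mx; exists 0; rewrite mulr0 subr0.
  have [J1|nJ1] := pselect (J 1).
    have [c mc] := J1; rewrite -[b](subrK (a * b * c)); apply: (mA).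
      by have := mM b _ mc; rewrite mulrBr mulr1 mulrCA mulrA.
    by rewrite mulrC; exact: mM.
  have /mmax JE : idealr_closed [in J].
    apply/maximal_idealP; split=> //; first by exists 0; rewrite mulr0 subr0.
    move=> t u v [c mc] [d md]; exists (t * c + d).
    have -> : t * u + v - a * (t * c + d) = t * (u - a * c) + (v - a * d).
      by rewrite mulrDr opprD addrACA mulrBr [a * (t * c)]mulrCA.
    exact: mD.
  by case: nma; rewrite -JE //; exists 1; rewrite mulr1 subrr.
have [A [kap [j [[jk hj] js]]]] := enough_points_seq hm s.
have jsurj x : exists a, j a = x.
  pose S : {pred R} := [pred x | `[< exists a, j a = x >]].
  have SP y : y \in S <-> exists a, j a = y by split=> /asboolP.
  suff hS : GRing.subalg_closed S.
    by have /asboolP : x \in S by apply: gen => // y /js jy; apply/asboolP.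
  split=> [|k u v /SP[a <-] /SP[b <-]|u v /SP[a <-] /SP[b <-]]; apply/SP.
  - by exists 1; rewrite rmorph1.
  - by exists (kap k * a + b); rewrite rmorphD rmorphM jk mulr_algl.
  - by exists (a * b); rewrite rmorphM.
have [|phi [phik phim _]] := hj 1; first by rewrite rmorph1.
pose g x := projT1 (cid (jsurj x)).
have gK x : j (g x) = x by rewrite /g; case: cid.
pose chi x := phi (g x).
have chij a : chi (j a) = phi a.
  apply/eqP; rewrite -subr_eq0 -rmorphB phim // rmorphB gK subrr; exact: m0.
have chi_lin : linear_for *%R chi.
  move=> k u v; rewrite -[u]gK -[v]gK -mulr_algl -jk -rmorphM -rmorphD !chij.
  by rewrite rmorphD rmorphM phik.
have chi_mul : monoid_morphism chi.
  split=> [|u v]; first by rewrite -(rmorph1 j) chij rmorph1.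
  by rewrite -[u]gK -[v]gK -rmorphM !chij rmorphM.
pose Lchi := GRing.isLinear.Build K R K^o *:%R chi chi_lin.
pose Mchi := GRing.isMonoidMorphism.Build R K^o chi chi_mul.
pose chi' : {lrmorphism R -> K^o} := HB.pack chi Lchi Mchi.
exists chi'; apply/esym/mmax; first exact: kernel_idealr_closed.
by move=> x mx; apply: phim; rewrite gK.
Qed.

End Nullstellensatz.

(** * Quantum sums *)

(** The quantum integer [[n]_x], as a sum so as to make sense at [x = 1]. *)
Definition geo_sum (K : pzSemiRingType) (x : K) (n : nat) : K :=
  \sum_(i < n) x ^+ i.

Section GeometricSum.
Variables (K : comPzRingType) (x : K).

Lemma geo_sum0 : geo_sum x 0 = 0.
Proof. exact: big_ord0. Qed.

Lemma geo_sum_recr n : geo_sum x n.+1 = geo_sum x n + x ^+ n.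
Proof. exact: big_ord_recr. Qed.

Lemma geo_sumD k n : geo_sum x (k + n) = geo_sum x k + x ^+ k * geo_sum x n.
Proof.
rewrite /geo_sum big_split_ord mulr_sumr; congr (_ + _).
by apply: eq_bigr => i _; rewrite exprD.
Qed.

Lemma geo_sum_recl n : geo_sum x n.+1 = 1 + x * geo_sum x n.
Proof. by rewrite -add1n geo_sumD geo_sum_recr geo_sum0 add0r. Qed.

Lemma geo_sum_subX1 n : (x - 1) * geo_sum x n = x ^+ n - 1.
Proof. by rewrite subrX1. Qed.

End GeometricSum.

Lemma geo_sum_double (K : comPzRingType) (x : K) n :
  geo_sum x (2 * n) = (1 + x) * geo_sum (x ^+ 2) n.
Proof.
elim: n => [|n IH]; first by rewrite muln0 /geo_sum !big_ord0 mulr0.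
rewrite mulnS !addSn add0n !geo_sum_recr IH -exprM.
by rewrite [x ^+ (2 * n).+1]exprS; ring.
Qed.

Lemma geo_sum_double1 (K : comPzRingType) (x : K) n :
  geo_sum x (2 * n).+1 = geo_sum (x ^+ 2) n.+1 + x * geo_sum (x ^+ 2) n.
Proof. by rewrite !geo_sum_recr geo_sum_double -exprM; ring. Qed.

Section QuantumSums.
Variables (K : fieldType) (charK : [pchar K] =i pred0) (q beta : K).
Variables (gam : nat -> K).
Hypotheses (q0 : q != 0) (beta0 : beta != 0).
Hypothesis gamS : forall i, gam i.+1 = q^-1 * gam i - beta * q ^+ i.

Local Notation S := (geo_sum q).
Local Notation T := (geo_sum (q ^+ 2)).
Local Notation C n := (\sum_(i < n) gam i).

(* For [n = 2 j + i - 1] with [i = 1, 2] and [gam i = xi^-i chi(sigma^i h)], this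
   says that [chi sigma^j] lies in [G_((i-1)/2)]. *)
Definition geo_rel (n : nat) : Prop :=
  if odd n then gam n./2 + gam n./2.+1 = 0 else gam n./2 = 0.

(** Expresses that [n] is below [N]; the first alternative is the convention that [N] is infinite
    when [q ^+ 2 = 1]. *)
Definition no_root_below (n : nat) : Prop :=
  q ^+ 2 = 1 \/ forall d, (0 < d <= n)%N -> q ^+ d != 1.

Lemma pchar0_natr_eq0 n : (n%:R == 0 :> K) = (n == 0)%N.
Proof. by rewrite (proj1 (pcharf0P K) charK). Qed.

(** Multiplied by [q ^+ i.+1], the recursion telescopes, with increments
    [- beta * q * q ^+ (2 * i)]. *)
Lemma gam_explicit i : q ^+ i * gam i = gam 0 - beta * q * T i.
Proof.
elim: i => [|i IH]; first by rewrite geo_sum0 mulr0 subr0 mul1r.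
have -> : q ^+ i.+1 * gam i.+1 = q ^+ i * gam i - beta * q * q ^+ (2 * i).
  by rewrite gamS exprS mul2n -addnn exprD; field.
by rewrite IH geo_sum_recr -exprM; ring.
Qed.

(* At [q = -1] both sides vanish, hence the separate treatment of that case. *)
Lemma sum_gam n :
  (1 + q) * q ^+ n * C n.+1 = S n.+1 * ((1 + q) * gam 0 - beta * q * S n).
Proof.
elim: n => [|n IH].
  by rewrite big_ord1 geo_sum_recr geo_sum0 expr0; ring.
have -> : C n.+2 = C n.+1 + gam n.+1 by exact: big_ord_recr.
have e : (1 + q) * q ^+ n.+1 * gam n.+1 =
    (1 + q) * gam 0 - beta * q * S (2 * n.+1).
  by rewrite -mulrA gam_explicit geo_sum_double; ring.
(* The terms in [beta] then combine through [q * S n + 1 + q ^+ n.+1 = S n.+2]. *)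
have e2 : S (2 * n.+1) = S n.+1 * (1 + q ^+ n.+1).
  by rewrite mul2n -addnn geo_sumD mulrDr mulr1 mulrC.
have -> : (1 + q) * q ^+ n.+1 * (C n.+1 + gam n.+1) =
    q * ((1 + q) * q ^+ n * C n.+1) + (1 + q) * q ^+ n.+1 * gam n.+1.
  by rewrite exprS; ring.
rewrite IH e e2 (geo_sum_recl _ n.+1).
have -> : q ^+ n.+1 = S n.+2 - S n.+1.
  by rewrite [S n.+2]geo_sum_recr [S n.+1 + _]addrC addrK.
rewrite (geo_sum_recl _ n.+1) (geo_sum_recl _ n); ring.
Qed.

Lemma geo_rel_doubleE j : geo_rel (2 * j) <-> gam 0 = beta * q * T j.
Proof.
rewrite /geo_rel mul2n odd_double doubleK; have e := gam_explicit j.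
split=> [g0|a0].
  by move: e; rewrite g0 mulr0 => /esym/eqP; rewrite subr_eq0 => /eqP.
move: e; rewrite a0 subrr => /eqP; rewrite mulf_eq0 expf_eq0 (negPf q0) andbF.
by move/eqP.
Qed.

Section Generic.
Hypothesis q1 : 1 + q != 0.

(** Treats [G_0] and [G_(1/2)] uniformly: [(1 + q) * q ^+ j * gam j] and
    [q ^+ j.+1 * (gam j + gam j.+1)] are the second factor in [sum_gam] for [n = 2 j] and
    [n = 2 j + 1]. *)
Lemma geo_relE n : geo_rel n <-> (1 + q) * gam 0 = beta * q * S n.
Proof.
rewrite -[n]odd_double_half -mul2n; case: (odd n) => /=; last first.
  rewrite add0n geo_rel_doubleE geo_sum_double; split=> [->|e]; first by ring.
  by apply: (mulfI q1); rewrite e; ring.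
move: n./2 => j; rewrite add1n /geo_rel oddS mul2n odd_double /= uphalf_double.
have := gam_explicit j.+1; have := gam_explicit j => e1 e2.
have e : q ^+ j.+1 * (gam j + gam j.+1) = (1 + q) * gam 0 - beta * q * S j.*2.+1.
  rewrite -mul2n geo_sum_double1 mulrDr e2 exprS -mulrA e1; ring.
split=> [g0|a0].
  by move: e; rewrite g0 mulr0 => /esym/eqP; rewrite subr_eq0 => /eqP.
move: e; rewrite a0 subrr => /eqP; rewrite mulf_eq0 expf_eq0 (negPf q0) andbF.
by move/eqP.
Qed.

Lemma sum_gam_eq0 n : C n.+1 = 0 <-> S n.+1 = 0 \/ geo_rel n.
Proof.
rewrite geo_relE; have e := sum_gam n; split=> [C0|h].
  move: e; rewrite C0 mulr0 => /esym/eqP; rewrite mulf_eq0 subr_eq0.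
  by case/orP=> /eqP; [left | right].
have : (1 + q) * q ^+ n * C n.+1 = 0.
  by rewrite e; case: h => ->; rewrite ?mul0r ?subrr ?mulr0.
by move/eqP; rewrite !mulf_eq0 expf_eq0 (negPf q0) (negPf q1) andbF => /eqP.
Qed.

(** At [q = 1] the sum is [n], nonzero in characteristic zero. Otherwise
    [(q - 1) * S n = q ^+ n - 1], and [q ^+ 2 = 1] would force [q = -1]. *)
Lemma geo_sum_neq0 n : (0 < n)%N -> no_root_below n -> S n != 0.
Proof.
move=> n0 hn; have [q_1|q_1] := eqVneq q 1.
  rewrite /geo_sum q_1 (eq_bigr (fun=> 1)) => [|i _]; last by rewrite expr1n.
  by rewrite sumr_const card_ord pchar0_natr_eq0 -lt0n.
apply/eqP => S0; have := geo_sum_subX1 q n; rewrite S0 mulr0 => /esym/eqP.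
case: hn => [q2|hn]; last by rewrite subr_eq0 (negPf (hn _ _)) // n0 leqnn.
move/eqP: q2; rewrite -subr_eq0 subr_sqr_1 mulf_eq0 subr_eq0 (negPf q_1).
by rewrite addrC (negPf q1).
Qed.

End Generic.

Lemma gam_N1 : q = -1 -> forall i, gam i = (-1) ^+ i * (gam 0 + beta * i%:R).
Proof.
move=> qN i; elim: i => [|i IH]; first by rewrite mulr0 addr0 mul1r.
by rewrite gamS qN IH invrN1 exprS -natr1; ring.
Qed.

(** The terms [gam (2 * k)] and [gam (2 * k).+1] add up to [- beta]. *)
Lemma sum_gam_N1 : q = -1 ->
  forall j, C (2 * j) = - (beta * j%:R) /\ C (2 * j).+1 = gam 0 + beta * j%:R.
Proof.
move=> qN j; have sg k : (-1) ^+ (2 * k) = 1 :> K.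
  by rewrite exprM sqrrN expr1n expr1n.
have CS n : C n.+1 = C n + gam n by exact: big_ord_recr.
have odd_of k :
    C (2 * k) = - (beta * k%:R) -> C (2 * k).+1 = gam 0 + beta * k%:R.
  by move=> e; rewrite CS e (gam_N1 qN (2 * k)) sg natrM; ring.
have ev : C (2 * j) = - (beta * j%:R).
  elim: j => [|k IH]; first by rewrite big_ord0 mulr0 oppr0.
  rewrite mulnS !addSn add0n CS odd_of // (gam_N1 qN (2 * k).+1) exprS sg.
  by rewrite -!natr1 natrM; ring.
by split=> //; exact: odd_of.
Qed.

(** Here [gam j + gam j.+1] is [beta] up to sign, so the condition for [G_(1/2)] never holds. *)
Lemma geo_rel_N1 : q = -1 -> forall j,
  (geo_rel (2 * j) <-> gam 0 + beta * j%:R = 0) /\ ~ geo_rel (2 * j).+1.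
Proof.
move=> qN j; split;
  rewrite /geo_rel ?oddS mul2n odd_double /= ?doubleK ?uphalf_double.
  rewrite (gam_N1 qN); split=> [/eqP|->]; last by rewrite mulr0.
  by rewrite mulf_eq0 expf_eq0 oppr_eq0 oner_eq0 andbF => /eqP.
rewrite (gam_N1 qN j) (gam_N1 qN j.+1) exprS -natr1 => e.
have : (-1) ^+ j * beta = 0.
  by apply/eqP; rewrite -oppr_eq0 -[X in _ == X]e; apply/eqP; ring.
by apply/eqP; rewrite mulf_neq0 // expf_neq0 // oppr_eq0 oner_eq0.
Qed.

Lemma q_N1P : {1 + q != 0} + {q = -1}.
Proof.
have [q1|q1] := boolP (1 + q == 0); [right|by left].
by apply/eqP; rewrite -addr_eq0 addrC.
Qed.

Lemma sum_gam_geo_rel n : no_root_below n.+1 -> C n.+1 = 0 -> geo_rel n.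
Proof.
move=> hn C0; have [q1|qN] := q_N1P.
  by case/(sum_gam_eq0 q1): C0 => // /eqP; rewrite (negPf (geo_sum_neq0 q1 _ hn)).
move: C0; rewrite -[n]odd_double_half -mul2n; case: (odd n) => /=.
  rewrite add1n -[(_).+2]/(2 + _)%N -mulnS (proj1 (sum_gam_N1 qN _)) => /eqP.
  by rewrite oppr_eq0 mulf_eq0 (negPf beta0) pchar0_natr_eq0.
by rewrite add0n (proj2 (sum_gam_N1 qN _)) => C0; apply/(proj1 (geo_rel_N1 qN _)).
Qed.

Lemma geo_rel_sum_gam n : geo_rel n -> C n.+1 = 0.
Proof.
have [q1|qN] := q_N1P; first by move=> r; apply/(sum_gam_eq0 q1); right.
rewrite -[n]odd_double_half -mul2n; case: (odd n) => /=.
  by rewrite add1n => /(proj2 (geo_rel_N1 qN _)).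
by rewrite add0n (proj2 (sum_gam_N1 qN _)) => /(proj1 (geo_rel_N1 qN _)).
Qed.

(** Both relations together would annihilate [S n - S k = q ^+ k * S (n - k)]. This gives the
    minimality of the dimension found in part c). *)
Lemma geo_rel_inj n k : (k < n)%N -> no_root_below n -> geo_rel n -> ~ geo_rel k.
Proof.
move=> kn hn; have [q1|qN] := q_N1P.
  rewrite !(geo_relE q1) => -> /eqP; rewrite -subr_eq0 -mulrBr.
  rewrite !mulf_eq0 (negPf beta0) (negPf q0) /= -(subnKC (ltnW kn)).
  rewrite geo_sumD [S k + _]addrC addrK.
  rewrite mulf_eq0 expf_eq0 (negPf q0) andbF /=; apply/negP.
  apply: geo_sum_neq0 => //; first by rewrite subn_gt0.
  case: hn => [|hn]; [by left | right=> d /andP[d0 dn]].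
  by rewrite hn // d0 (leq_trans dn) // leq_subr.
move: kn; rewrite -[n]odd_double_half -[k]odd_double_half -!mul2n.
case: (odd n) => /=; first by rewrite add1n => _ /(proj2 (geo_rel_N1 qN _)).
case: (odd k) => /=; first by rewrite add1n => _ _ /(proj2 (geo_rel_N1 qN _)).
rewrite !add0n ltn_pmul2l // => lt.
move=> /(proj1 (geo_rel_N1 qN _)) e1 /(proj1 (geo_rel_N1 qN _)) e2.
have := congr2 (fun x y => x - y) e1 e2; rewrite subrr opprD addrACA subrr add0r.
rewrite -mulrBr -natrB 1?ltnW // => /eqP.
by rewrite mulf_eq0 (negPf beta0) pchar0_natr_eq0 subn_eq0 leqNgt lt.
Qed.

Lemma sum_gam_order N : (0 < N)%N -> q ^+ 2 != 1 -> q ^+ N = 1 -> C N = 0.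
Proof.
case: N => // N _ q2 qN; have q1 : 1 + q != 0.
  apply: contraNneq q2 => /eqP; rewrite addrC addr_eq0 => /eqP->.
  by rewrite sqrrN expr1n.
apply/(sum_gam_eq0 q1); left; have := geo_sum_subX1 q N.+1; rewrite qN subrr => /eqP.
rewrite mulf_eq0 subr_eq0 => /orP[/eqP qq|/eqP //].
by move: q2; rewrite qq expr1n eqxx.
Qed.

(** Since [q ^+ 2] is a nontrivial root of unity of order dividing [p], [T p = 0]. *)
Lemma gam_half_order p : q ^+ 2 != 1 -> q ^+ (2 * p) = 1 -> gam p = q ^- p * gam 0.
Proof.
move=> q2 qp; have : q ^+ p * gam p = gam 0.
  rewrite gam_explicit; suff -> : T p = 0 by rewrite mulr0 subr0.
  have : (q ^+ 2 - 1) * T p = 0 by rewrite geo_sum_subX1 -exprM qp subrr.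
  by move/eqP; rewrite mulf_eq0 subr_eq0 (negPf q2) => /eqP.
by move=> <-; rewrite mulKf // expf_neq0.
Qed.

End QuantumSums.

(** * The Hopf algebra R and its group of weights *)

Section TensorLift.
Variable K : comNzRingType.

Lemma tlift_comp (V W U U' : lmodType K) (g : {linear U -> U'})
    (B : V -> W -> U) x :
  g (tlift B x) = tlift (fun v w => g (B v w)) x.
Proof. by rewrite /tlift /tsum linear_sum. Qed.

Lemma eq_tlift (V W : lmodType K) (U : nmodType) (B B' : V -> W -> U) :
  (forall v w, B v w = B' v w) -> tlift B =1 tlift B'.
Proof. by move=> e x; apply: eq_bigr => p _; rewrite e. Qed.

Lemma tlift_mulr (V W : lmodType K) (A : pzRingType) (B : V -> W -> A) c x :
  tlift (fun v w => B v w * c) x = tlift B x * c.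
Proof. by rewrite /tlift /tsum mulr_suml. Qed.

Lemma tlift_mull (V W : lmodType K) (A : pzRingType) (B : V -> W -> A) c x :
  tlift (fun v w => c * B v w) x = c * tlift B x.
Proof. by rewrite /tlift /tsum mulr_sumr. Qed.

Lemma tlift_exchange (V W V' W' : lmodType K) (U : nmodType)
    (F : V -> W -> V' -> W' -> U) s t :
  tlift (fun a b => tlift (fun c d => F a b c d) t) s =
  tlift (fun c d => tlift (fun a b => F a b c d) s) t.
Proof. exact: exchange_big. Qed.

Lemma linear_tlift (X V W U : lmodType K) (B : X -> V -> W -> U) t :
  (forall v w, linear (fun x => B x v w)) -> linear (fun x => tlift (B x) t).
Proof.
move=> hB k x y; rewrite /tlift /tsum scaler_sumr -big_split.
by apply: eq_bigr => p _; rewrite hB.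
Qed.

Section Sum.
Variables (V W U : lmodType K) (B : V -> W -> U).
Hypothesis hB : bilinear_for *:%R *:%R B.

Lemma tlift_scale k x : tlift B (k *: x) = k *: tlift B x.
Proof.
pose M := GRing.isLinear.Build K (V ⊗ W) U *:%R (tlift B) (tsum_bilinear_linear hB).
pose f : {linear V ⊗ W -> U} := HB.pack (tlift B) M.
by rewrite -[tlift B]/(f : _ -> _) linearZ.
Qed.

Lemma tlift_sum (I : Type) (r : seq I) (F : I -> V ⊗ W) :
  tlift B (\sum_(i <- r) F i) = \sum_(i <- r) tlift B (F i).
Proof.
pose M := GRing.isLinear.Build K (V ⊗ W) U *:%R (tlift B) (tsum_bilinear_linear hB).
pose f : {linear V ⊗ W -> U} := HB.pack (tlift B) M.
exact: (raddf_sum f).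
Qed.

Lemma tlift_tmap (V' W' : lmodType K) (f : V' -> V) (g : W' -> W) x :
  tlift B (tmap f g x) = tlift (fun v w => B (f v) (g w)) x.
Proof.
rewrite /tmap {2}/tlift /tsum tlift_sum; apply: eq_bigr => p _.
exact: tlift_tens.
Qed.

End Sum.

Section Associator.
Variables (V1 V2 V3 U : lmodType K) (T : V1 -> V2 -> V3 -> U).
Hypotheses (T1 : forall y z, linear (fun x => T x y z))
  (T2 : forall x z, linear (fun y => T x y z)) (T3 : forall x y, linear (T x y)).

Lemma trilinear_left :
  bilinear_for *:%R *:%R (fun t z => tlift (fun x y => T x y z) t).
Proof.
split=> [z|t] k a b /=.
  by apply: tsum_bilinear_linear; split=> [y|x] l c d /=; [rewrite T1 | rewrite T2].
rewrite /tlift /tsum scaler_sumr -big_split; apply: eq_bigr => p _; exact: T3.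
Qed.

Lemma trilinear_right : bilinear_for *:%R *:%R (fun x t => tlift (T x) t).
Proof.
split=> [t|x] k a b /=; last first.
  by apply: tsum_bilinear_linear; split=> [z|y] l c d /=; [rewrite T2 | rewrite T3].
rewrite /tlift /tsum scaler_sumr -big_split; apply: eq_bigr => p _; exact: T1.
Qed.

Lemma tlift_tassoc (z : (V1 ⊗ V2) ⊗ V3) :
  tlift (fun x t => tlift (T x) t) (tassoc z) =
  tlift (fun t z => tlift (fun x y => T x y z) t) z.
Proof.
rewrite /tassoc {3}/tlift /tsum (tlift_sum trilinear_right).
apply: eq_bigr => p _; rewrite {2}/tlift /tsum (tlift_sum trilinear_right).
apply: eq_bigr => s _; rewrite (tlift_tens trilinear_right) tlift_tens //.
Qed.

End Associator.

Lemma mul_bilinear (R A : comAlgType K) (f g : {linear R -> A}) :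
  bilinear_for *:%R *:%R (fun x y => f x * g y).
Proof.
split=> [y|x] k a b /=; rewrite linearP.
- by rewrite mulrDl scalerAl.
- by rewrite mulrDr scalerAr.
Qed.

End TensorLift.

Section Antipode.
Variables (K : comNzRingType) (R : comAlgType K) (H : hopf_algebra R).
Local Notation Delta := (comult H).
Local Notation S := (antipode H).
Local Notation eps := (counit H).

(** Coassociativity in Sweedler notation: both sides are the sum of [T a' a'' a''']. *)
Lemma coassoc_trilinear (U : lmodType K) (T : R -> R -> R -> U) :
  (forall y z, linear (fun x => T x y z)) ->
  (forall x z, linear (fun y => T x y z)) -> (forall x y, linear (T x y)) ->
  forall a,
  tlift (fun b z => tlift (fun x y => T x y z) (Delta b)) (Delta a) =
  tlift (fun x b => tlift (T x) (Delta b)) (Delta a).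
Proof.
move=> T1 T2 T3 a; have := congr1 (tlift (fun x t => tlift (T x) t)) (coassoc H a).
rewrite tlift_tassoc // (tlift_tmap (trilinear_left T1 T2 T3)).
by rewrite (tlift_tmap (trilinear_right T1 T2 T3)).
Qed.

Lemma comult1 : Delta 1 = tens 1 1.
Proof. by case: (comult_morph H). Qed.

Lemma comultM a b : Delta (a * b) = Delta a * Delta b.
Proof. by case: (comult_morph H) => _ ->. Qed.

Lemma tlift_comultM (U : lmodType K) (B : R -> R -> U) :
  bilinear_for *:%R *:%R B -> forall a b,
  tlift B (Delta (a * b)) =
  tlift (fun a1 a2 => tlift (fun b1 b2 => B (a1 * b1) (a2 * b2)) (Delta b)) (Delta a).
Proof. by move=> hB a b; rewrite comultM /GRing.mul /= tlift_pi // tsum_mul. Qed.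

Lemma antipode1 : S 1 = 1.
Proof.
have := antipodel H 1; rewrite comult1 tlift_tens.
  by rewrite mulr1 rmorph1 scale1r.
exact: (mul_bilinear S idfun).
Qed.

(* [S (a b)] and [S a S b] are both inverse to the product, for the
   convolution of bilinear maps. *)
Lemma antipodeM (a b : R) : S (a * b) = S a * S b.
Proof.
(* Summed over the iterated coproducts of [a] ([x1 x2 z]) and [b] ([y1 y2 w]), [Q] gives [S a * S b]
   if the first two legs are contracted, and [S (a * b)] if the last two are. *)
pose Q (x1 x2 z y1 y2 w : R) := S (x1 * y1) * (x2 * y2) * (S z * S w).
have lx1 x2 z y1 y2 w : linear (fun x1 => Q x1 x2 z y1 y2 w).
  by move=> k u v; rewrite /Q mulrDl -scalerAl linearP !mulrDl -!scalerAl.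
have lx2 x1 z y1 y2 w : linear (fun x2 => Q x1 x2 z y1 y2 w).
  by move=> k u v; rewrite /Q mulrDl -scalerAl mulrDr -scalerAr mulrDl -scalerAl.
have lz x1 x2 y1 y2 w : linear (fun z => Q x1 x2 z y1 y2 w).
  by move=> k u v; rewrite /Q linearP mulrDl -scalerAl mulrDr -scalerAr.
have ly1 x1 x2 z y2 w : linear (fun y1 => Q x1 x2 z y1 y2 w).
  by move=> k u v; rewrite /Q mulrDr -scalerAr linearP !mulrDl -!scalerAl.
have ly2 x1 x2 z y1 w : linear (fun y2 => Q x1 x2 z y1 y2 w).
  by move=> k u v; rewrite /Q !mulrDr mulrDl -!scalerAr -scalerAl.
have lw x1 x2 z y1 y2 : linear (fun w => Q x1 x2 z y1 y2 w).
  by move=> k u v; rewrite /Q linearP !mulrDr -!scalerAr.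
pose T (x1 x2 z : R) :=
  tlift (fun y1 c => tlift (fun y2 w => Q x1 x2 z y1 y2 w) (Delta c)) (Delta b).
have TE x1 x2 z : T x1 x2 z =
    tlift (fun y w => tlift (fun y1 y2 => Q x1 x2 z y1 y2 w) (Delta y)) (Delta b).
  by rewrite coassoc_trilinear.
have counitS c : tlift (fun x z => (eps x : K) *: S z) (Delta c) = S c.
  rewrite -[in RHS](counitl H c) tlift_comp; apply: eq_tlift => x z.
  by apply/esym; exact: linearZ.
have counit_prod c d e f :
    tlift (fun x1 x2 => tlift (fun y1 y2 => Q x1 x2 e y1 y2 f) (Delta d)) (Delta c) =
    ((eps c : K) *: S e) * ((eps d : K) *: S f).
  pose B u v := S u * v * (S e * S f).
  have hB : bilinear_for *:%R *:%R B.
    split=> [v|u] k x y; rewrite /B; first by rewrite linearP !mulrDl -!scalerAl.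
    by rewrite mulrDr mulrDl -scalerAr -scalerAl.
  rewrite -(tlift_comultM hB) /B tlift_mulr antipodel rmorphM.
  by rewrite mulr_algl -scalerAl -scalerAr scalerA.
have counit_prod' c d e f :
    tlift (fun x2 x3 => tlift (fun y2 y3 => Q e x2 x3 f y2 y3) (Delta d)) (Delta c) =
    S (((eps c : K) *: e) * ((eps d : K) *: f)).
  transitivity (S (e * f) * (tlift (fun x y => x * S y) (Delta c) *
                             tlift (fun x y => x * S y) (Delta d))).
    rewrite -tlift_mulr -tlift_mull; apply: eq_tlift => x2 x3.
    rewrite -tlift_mull -tlift_mull; apply: eq_tlift => y2 y3.
    by rewrite /Q -mulrA [x2 * y2 * _]mulrACA.
  by rewrite !antipoder mulr_algl scalerA mulr_algr -scalerAl -scalerAr scalerA linearZ.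
apply/esym; transitivity
  (tlift (fun x z => tlift (fun x1 x2 => T x1 x2 z) (Delta x)) (Delta a)).
  transitivity (tlift (fun x z => tlift (fun y w =>
      ((eps x : K) *: S z) * ((eps y : K) *: S w)) (Delta b)) (Delta a)).
    rewrite -[in LHS](counitS a) -[in LHS](counitS b) -tlift_mulr.
    by apply: eq_tlift => x z; rewrite -tlift_mull.
  apply: eq_tlift => x z; rewrite (eq_tlift (fun x1 x2 => TE x1 x2 z)).
  rewrite -tlift_exchange; apply: eq_tlift => y w; by rewrite counit_prod.
rewrite coassoc_trilinear; first last.
- by move=> x y; do 2!apply: linear_tlift => ? ?.
- by move=> x y; do 2!apply: linear_tlift => ? ?.
- by move=> x y; do 2!apply: linear_tlift => ? ?.
rewrite -[in RHS](counitr H a) -[in RHS](counitr H b) -tlift_mulr tlift_comp.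
apply: eq_tlift => x c; rewrite tlift_exchange -tlift_mull tlift_comp.
by apply: eq_tlift => y d; rewrite counit_prod'.
Qed.

(** The sum of [S (S a') * S a'' * a'''] is [a] when the first two factors are contracted, [S] being
    multiplicative, and [S (S a)] when the last two are. *)
Lemma antipodeK : involutive S.
Proof.
move=> a; pose T x y z := S (S x) * (S y * z).
have Tl x y : linear (T x y) by move=> k u v; rewrite /T !mulrDr -!scalerAr.
have Tm x z : linear (fun y => T x y z).
  by move=> k u v; rewrite /T linearP mulrDl mulrDr -scalerAl -scalerAr.
have Tf y z : linear (fun x => T x y z).
  by move=> k u v; rewrite /T !linearP mulrDl -scalerAl.
have := coassoc_trilinear Tf Tm Tl a.
have -> : tlift (fun b z => tlift (fun x y => T x y z) (Delta b)) (Delta a) = a.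
  rewrite -[RHS](counitl H a); apply: eq_tlift => b z.
  rewrite (eq_tlift (B' := fun x y => S (S x * y) * z)) => [|x y].
    by rewrite tlift_mulr -tlift_comp antipodel linearZ /= antipode1 mulr_algl.
  by rewrite /T antipodeM mulrA.
have -> : tlift (fun x b => tlift (T x) (Delta b)) (Delta a) = S (S a).
  rewrite -[in RHS](counitr H a) !tlift_comp; apply: eq_tlift => x b.
  by rewrite /T tlift_mull antipodel mulr_algr !linearZ.
exact: esym.
Qed.

Lemma counit_antipode a : eps (S a) = eps a.
Proof.
have := congr1 eps (antipodel H a); rewrite tlift_comp linearZ /= rmorph1.
rewrite [_ *: _]mulr1 => <-; rewrite -{1}(counitr H a) !tlift_comp.
by apply: eq_tlift => x y; rewrite !linearZ rmorphM /= mulrC.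
Qed.

End Antipode.

Section Weights.
Variables (K : closedFieldType) (R : comAlgType K) (H : hopf_algebra R).
Local Notation Delta := (comult H).
Local Notation eps := (counit H).

Definition right_colinear (f : R -> R) : Prop :=
  forall a, tmap idfun f (Delta a) = Delta (f a).

Lemma tmap_idfun_comp (f : {linear R -> R}) (g : R -> R) (t : R ⊗ R) :
  tmap idfun f (tmap idfun g t) = tmap idfun (f \o g) t.
Proof.
rewrite [LHS]tlift_tmap //; have [tl tr] := @tens_bilinear K R R.
by split=> [y|x] k u v /=; [rewrite tl | rewrite linearP tr].
Qed.

Lemma right_colinear_comp (f g : {linear R -> R}) :
  right_colinear f -> right_colinear g -> right_colinear (f \o g).
Proof. by move=> hf hg a; rewrite -tmap_idfun_comp hg hf. Qed.

Lemma right_colinear_inv (f g : {linear R -> R}) :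
  cancel f g -> cancel g f -> right_colinear f -> right_colinear g.
Proof.
move=> fK gK hf a; rewrite -{1}[a]gK -hf tmap_idfun_comp.
rewrite [RHS](tensE (Delta (g a))); apply: eq_bigr => p _; by rewrite /= fK.
Qed.

Lemma tlift_counit (chi : {lrmorphism R -> K^o}) a :
  tlift (fun x y => (chi x : K) * (eps y : K)) (Delta a) = chi a.
Proof.
rewrite -[in RHS](counitr H a) tlift_comp; apply: eq_tlift => x y.
by rewrite linearZ mulrC.
Qed.

Lemma mul_characters_bilinear (chi psi : {lrmorphism R -> K^o}) :
  bilinear_for *:%R *:%R (fun x y => chi x * psi y : K^o).
Proof. exact: mul_bilinear. Qed.

Lemma kernel_img (f g : {lrmorphism R -> R}) (chi : {lrmorphism R -> K^o}) :
  cancel f g -> cancel g f -> f @` kernel chi = kernel (chi \o g).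
Proof.
move=> fK gK; apply/seteqP; split=> [_ [a ca <-]|a ca].
  by rewrite kernelE /= fK.
by exists (g a); rewrite ?gK.
Qed.

(** By colinearity [Delta a] is [(Id (x) f) Delta (g a)]; applying [eps \o g] to the right leg
    undoes [f] and leaves the counit axiom for [g a]. *)
Lemma wadd_kernel (f g : {lrmorphism R -> R}) (chi : {lrmorphism R -> K^o}) :
  cancel f g -> cancel g f -> right_colinear f ->
  wadd H (kernel chi) (f @` wzero H) = kernel (chi \o g).
Proof.
move=> fK gK hf; rewrite (kernel_img eps fK gK) /wadd /kernel.
apply/funext => a; congr (_ = 0).
transitivity (tlift (fun x y => chi x * eps (g y) : K^o) (Delta a)).
  by apply: eq_bigr => p _; rewrite !ev_kernel.
rewrite -{1}[a]gK -hf.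
rewrite (tlift_tmap (mul_characters_bilinear chi (eps \o g))).
rewrite [RHS]/= -tlift_counit; apply: eq_bigr => p _; by rewrite /= fK.
Qed.

End Weights.

(** Bundled, so that composing a character with it yields a character again. *)
Fixpoint iter_morphism (K : comNzRingType) (R : comAlgType K)
    (f : {lrmorphism R -> R}) (n : nat) : {lrmorphism R -> R} :=
  if n is n'.+1 then f \o iter_morphism f n' else idfun.

Definition zpow_morphism (K : comNzRingType) (R : comAlgType K)
    (f g : {lrmorphism R -> R}) (z : int) : {lrmorphism R -> R} :=
  match z with Posz n => iter_morphism f n | Negz n => iter_morphism g n.+1 end.

Section ZPow.
Variables (K : fieldType) (R : comAlgType K).
Implicit Types f g : {lrmorphism R -> R}.

Lemma iter_morphismE f n a : iter_morphism f n a = iter n f a.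
Proof. by elim: n => //= n ->. Qed.

Lemma iter_morphismK f g n :
  cancel f g -> cancel (iter_morphism f n) (iter_morphism g n).
Proof.
move=> fK a; rewrite !iter_morphismE; elim: n a => //= n IH a.
by rewrite -iterS iterSr fK IH.
Qed.

Lemma zpow_morphismE f g z a : zpow_morphism f g z a = zpow f g z a.
Proof. by case: z => n; exact: iter_morphismE. Qed.

Lemma zpow_morphismK f g z : cancel f g -> cancel g f ->
  cancel (zpow_morphism f g z) (zpow_morphism g f z).
Proof. by case: z => n fK gK; exact: iter_morphismK. Qed.

End ZPow.

Section HopfConditions.
Variables (K : closedFieldType) (R : comAlgType K) (H : hopf_algebra R).
Variables (sigma sigmaV : {lrmorphism R -> R}).
Hypotheses (sigmaK : cancel sigma sigmaV) (sigmaVK : cancel sigmaV sigma).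
Variables (h : R) (xi : K) (xi_neq0 : xi != 0) (rp rm lp lm sp sm : R).
Hypothesis hH : hopf_conditions H sigma sigmaV h xi rp rm lp lm sp sm.
Local Notation Delta := (comult H).
Local Notation eps := (counit H).
Local Notation un := (wint H sigma sigmaV).

Lemma right_colinear_iter (f : {lrmorphism R -> R}) n :
  right_colinear H f -> right_colinear H (iter_morphism f n).
Proof.
move=> hf; elim: n => [a|n IH]; last exact: right_colinear_comp.
by rewrite [RHS](tensE (Delta a)).
Qed.

Lemma right_colinear_zpow z : right_colinear H (zpow_morphism sigma sigmaV z).
Proof.
have hs : right_colinear H sigma by exact: sigma_comultr hH.
case: z => n; apply: right_colinear_iter => //.
exact: (right_colinear_inv sigmaK).
Qed.

Lemma wintE z : un z = zpow_morphism sigma sigmaV z @` wzero H.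
Proof.
by rewrite /wint; congr (_ @` _); apply/funext => a; rewrite zpow_morphismE.
Qed.

Lemma wint_kernel z : un z = kernel (eps \o zpow_morphism sigmaV sigma z).
Proof.
rewrite wintE (kernel_img eps (zpow_morphismK z sigmaK sigmaVK)) //.
exact: zpow_morphismK.
Qed.

Lemma wadd_wint (chi : {lrmorphism R -> K^o}) z :
  wadd H (kernel chi) (un z) = kernel (chi \o zpow_morphism sigmaV sigma z).
Proof.
rewrite wintE (wadd_kernel chi (zpow_morphismK z sigmaK sigmaVK)) //.
  exact: zpow_morphismK.
exact: right_colinear_zpow.
Qed.

Lemma wopp_wint1 : wopp H (un 1) = un (-1).
Proof.
rewrite !wint_kernel; have Ss := sigma_antipode hH.
apply/seteqP; split=> [_ [a a0 <-]|a a0].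
  move: a0; rewrite !kernelE /= -{2}[a]sigmaVK Ss sigmaVK => <-.
  exact: counit_antipode.
exists (antipode H a); last exact: antipodeK.
by move: a0; rewrite !kernelE /= -Ss => <-; exact: counit_antipode.
Qed.

Lemma scale_bilinear (chi : {lrmorphism R -> K^o}) :
  bilinear_for *:%R *:%R (fun x y : R => (chi y : K) *: x).
Proof.
split=> [y|x] k u v /=; first by rewrite scalerDr !scalerA mulrC.
by rewrite linearP scalerDl scalerA.
Qed.

(** The counit axiom recovers a colinear [f] from the functional [eps \o f]. Hence [f] acts by a
    scalar on grouplike elements. *)
Lemma colinearE (f : {lrmorphism R -> R}) a : right_colinear H f ->
  f a = tlift (fun x y => (eps (f y) : K) *: x) (Delta a).
Proof.
by move=> hf; rewrite -{1}(counitr H (f a)) -hf (tlift_tmap (scale_bilinear eps)).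
Qed.

Lemma grouplike_colinear (f : {lrmorphism R -> R}) g :
  right_colinear H f -> grouplike H g -> f g = (eps (f g) : K) *: g.
Proof.
move=> hf [Dg _]; rewrite {1}(colinearE _ hf) Dg.
exact: (tlift_tens (scale_bilinear (eps \o f))).
Qed.

Lemma grouplikeM g g' : grouplike H g -> grouplike H g' -> grouplike H (g * g').
Proof.
move=> [Dg eg] [Dg' eg']; split; first by rewrite comultM Dg Dg' tens_mul.
by rewrite rmorphM /= eg eg' mulr1.
Qed.

(** [antipode H g] is an inverse of [g]. *)
Lemma grouplike_neq0 (chi : {lrmorphism R -> K^o}) g : grouplike H g -> chi g != 0.
Proof.
move=> [Dg eg]; have := antipoder H g; rewrite Dg eg scale1r.
rewrite tlift_tens; last exact: (mul_bilinear idfun (antipode H)).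
move/(congr1 chi); rewrite rmorphM rmorph1 /= => e; apply/eqP => g0.
by move/eqP: e; rewrite g0 mul0r eq_sym oner_eq0.
Qed.

Let r := rp * rm.
Let l := lp * lm.
Let r1 : K := ev (un 1) r.
Let h1 : K := ev (un 1) h.
Let q := xi * r1.

Lemma ev_un1 a : ev (un 1) a = eps (sigmaV a).
Proof. by rewrite wint_kernel ev_kernel. Qed.

(** Colinearity expands [sigma r], [sigma l] and [sigma h] with coefficients [rho], [mu] and [eta].
    Evaluating at the weight 1, whose character [psi] satisfies [psi \o sigma = eps], ties them to
    [r1] and [h1]. The last relation, [rho * mu = xi ^+ 2], comes from applying [eps (x) eps] to the
    conditions on [sigma(l_+-) (x) sigma(r_-+)]. *)
Lemma sigma_structure :
  [/\ q != 0, sigma h = (xi / q) *: h - (xi ^+ 2 * h1) *: l &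
      sigma l = (xi * q) *: l].
Proof.
have hs : right_colinear H sigma by exact: sigma_comultr hH.
have gr : grouplike H r by apply: grouplikeM; case: hH.
have gl : grouplike H l by apply: grouplikeM; case: hH.
pose rho : K := eps (sigma r); pose mu : K := eps (sigma l).
pose eta : K := eps (sigma h).
have sr : sigma r = rho *: r by exact: grouplike_colinear.
have sl : sigma l = mu *: l by exact: grouplike_colinear.
pose psi : {lrmorphism R -> K^o} := eps \o sigmaV.
have psiE a : ev (un 1) a = psi a by rewrite ev_un1.
have psiK a : psi (sigma a) = eps a by rewrite /psi /= sigmaK.
have rho_r1 : rho * r1 = 1.
  by have := congr1 psi sr; rewrite linearZ psiK /r1 psiE; case: gr => _ -> <-.
have mu_l1 : mu * (psi l : K) = 1.
  by have := congr1 psi sl; rewrite linearZ psiK; case: gl => _ -> <-.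
have sh : sigma h = rho *: h + eta *: l.
  rewrite (colinearE _ hs) (comult_h hH) -[tens h _]scale1r.
  have hB := scale_bilinear (eps \o sigma).
  rewrite (tsum_bilinear_linear hB) !(tlift_tens hB) scale1r.
  by [].
have eta_h1 : rho * h1 + eta * (psi l : K) = 0.
  have := congr1 psi sh; rewrite linearD !linearZ psiK (counit_h hH) /h1 psiE.
  by move <-.
have eps2 g g' : grouplike H g -> grouplike H g' ->
    tens (sigma g) (sigma g') = xi *: tens g g' ->
    (eps (sigma g) : K) * (eps (sigma g') : K) = xi.
  move=> [_ eg] [_ eg'] e; have hB := mul_characters_bilinear eps eps.
  have := congr1 (tlift (fun x y => eps x * eps y : K^o)) e.
  by rewrite tlift_scale // !tlift_tens // eg eg' mulr1 => ->; exact: mulr1.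
have rho_mu : rho * mu = xi ^+ 2.
  have e1 := eps2 _ _ (grouplike_lp hH) (grouplike_rm hH) (sigma_lp_rm hH).
  have e2 := eps2 _ _ (grouplike_lm hH) (grouplike_rp hH) (sigma_lm_rp hH).
  rewrite /rho /mu /r /l !rmorphM /= expr2 -{1}e1 -e2.
  by rewrite [X in X * _ = _]mulrC mulrACA [X in X * _ = _]mulrC [X in _ * X = _]mulrC.
have r1_neq0 : r1 != 0.
  by apply: contra_eq_neq rho_r1 => ->; rewrite mulr0 eq_sym oner_neq0.
have rhoE : rho = xi / q.
  rewrite /q invfM mulrA divff // mul1r; apply: (mulIf r1_neq0).
  by rewrite rho_r1 mulVf.
have muE : mu = xi * q.
  have rho0 : rho != 0.
    by apply: contra_eq_neq rho_r1 => ->; rewrite mul0r eq_sym oner_neq0.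
  apply: (mulfI rho0).
  by rewrite rho_mu /q [xi * (_ * _)]mulrA mulrCA rho_r1 mulr1 expr2.
have etaE : eta = - (xi ^+ 2 * h1).
  have -> : eta = mu * (eta * psi l) by rewrite mulrCA mu_l1 mulr1.
  move/eqP: eta_h1; rewrite addrC addr_eq0 => /eqP ->.
  by rewrite mulrN mulrA [mu * rho]mulrC rho_mu.
split; first by rewrite mulf_neq0.
  by rewrite sh rhoE etaE scaleNr.
by rewrite sl muE.
Qed.

Lemma character_lplm_neq0 (chi : {lrmorphism R -> K^o}) : chi l != 0.
Proof. by apply: grouplike_neq0; apply: grouplikeM; case: hH. Qed.

End HopfConditions.

(** * Generation of A *)

Section Subalgebra.
Variables (K : comNzRingType) (A : algType K) (P : {pred A}).
Hypothesis hP : GRing.subalg_closed P.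

(** The closure proof is a phantom argument, so that the algebra structure can be attached to the
    predicate. *)
Definition subalg_pred of GRing.subalg_closed P : A -> bool := fun x => x \in P.

Lemma subalg_pred_closed : GRing.subsemialg_closed (subalg_pred hP).
Proof. exact: (GRing.subalg_closed_semi hP). Qed.

HB.instance Definition _ :=
  GRing.isSubSemiAlgClosed.Build K A (subalg_pred hP) subalg_pred_closed.

Record subalg := Subalg { subalg_val : A; _ : subalg_pred hP subalg_val }.
HB.instance Definition _ := [isSub for subalg_val].
HB.instance Definition _ := [Choice of subalg by <:].
HB.instance Definition _ := [SubChoice_isSubAlgebra of subalg by <:].

Lemma subalg_val_linear : linear subalg_val.
Proof. by []. Qed.

Lemma subalg_val_monoid : monoid_morphism subalg_val.
Proof. by []. Qed.

HB.instance Definition _ :=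
  GRing.isLinear.Build K subalg A *:%R subalg_val subalg_val_linear.
HB.instance Definition _ :=
  GRing.isMonoidMorphism.Build subalg A subalg_val subalg_val_monoid.

End Subalgebra.

Section Generation.
Variables (K : comNzRingType) (R : comAlgType K) (sigma sigmaV : R -> R).
Variables (h : R) (xi : K) (A : algType K) (iota : {lrmorphism R -> A}).
Variables (Xp Xm : A).
Hypothesis hA : is_ambiskew sigma sigmaV h xi iota Xp Xm.

(* The inclusion of the subalgebra [P] in [A] has a section, by the universal
   property of [A]. *)
Lemma ambiskew_ind (P : {pred A}) : GRing.subalg_closed P ->
  (forall a, iota a \in P) -> Xp \in P -> Xm \in P -> forall x, x \in P.
Proof.
move=> hP Pi Pp Pm x; pose B : algType K := subalg hP.
have valB (b : B) : val b \in P by exact: (valP b).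
pose i a : B := Subalg (Pi a : subalg_pred hP (iota a)).
have i_lin : linear i by move=> k u v; apply: val_inj; rewrite /= linearP.
have i_mul : monoid_morphism i.
  split=> [|u v]; first by apply: val_inj; exact: rmorph1.
  by apply: val_inj; exact: rmorphM.
pose Li := GRing.isLinear.Build K R B *:%R i i_lin.
pose Mi := GRing.isMonoidMorphism.Build R B i i_mul.
pose i' : {lrmorphism R -> B} := HB.pack i Li Mi.
pose Yp : B := Subalg (Pp : subalg_pred hP Xp).
pose Ym : B := Subalg (Pm : subalg_pred hP Xm).
have [rp rm rpm] := ambiskew_rels hA.
have [|g [gi gp gm]] := ambiskew_ex hA (f := i') (Yp := Yp) (Ym := Ym).
  split=> [a|a|]; apply: val_inj; [exact: rp | exact: rm | exact: rpm].
pose v : {lrmorphism B -> A} := @subalg_val K A P hP.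
have vg : v \o g =1 idfun.
  apply: (ambiskew_uniq hA) => [a| |] /=; by rewrite ?gi ?gp ?gm.
rewrite -[x]vg; exact: valB.
Qed.

End Generation.

(** * Simple highest weight modules *)

Section Dimension.
Variables (K : fieldType) (A : algType K) (L : lmodType A).

Lemma scalarC (k : K) (a : A) (x : L) : k%:A *: (a *: x) = a *: (k%:A *: x).
Proof. by rewrite !scalerA mulr_algl mulr_algr. Qed.

Lemma scalarA (k l : K) (x : L) : k%:A *: (l%:A *: x) = (k * l)%:A *: x.
Proof. by rewrite scalerA mulr_algl scalerA. Qed.

Lemma scalar_eq0 (k : K) (x : L) : k != 0 -> k%:A *: x = 0 -> x = 0.
Proof.
move=> k0 e; rewrite -[x]scale1r -[1](scale1r (1 : A)) -(mulVf k0) -scalarA e.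
exact: scaler0.
Qed.

Definition kfree (m : nat) (u : 'I_m -> L) : Prop :=
  forall f : 'rV[K]_m, \sum_i (f 0 i)%:A *: u i = 0 -> f = 0.

Lemma kfree_leq_kdim n m (u : 'I_m -> L) : has_kdim L n -> kfree u -> (m <= n)%N.
Proof.
move=> [b hb] hu.
pose f i := projT1 (cid (hb (u i))).
have fE i : u i = \sum_j (f i 0 j)%:A *: b j by rewrite /f; case: cid => c [].
pose M := \matrix_(i < m) f i.
suff /eqP <- : row_free M by exact: rank_leq_col.
apply: inj_row_free => v vM; apply: hu.
under eq_bigr => i _ do rewrite fE scaler_sumr.
rewrite exchange_big big1 // => j _.
have : (v *m M) 0 j = 0 by rewrite vM mxE.
rewrite mxE => e; transitivity ((\sum_i v 0 i * M i j)%:A *: b j); last first.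
  by rewrite e !scale0r.
rewrite scaler_suml scaler_suml; apply: eq_bigr => i _.
by rewrite scalarA !mxE.
Qed.

Lemma has_kdim_free n (b : 'I_n -> L) :
  (forall x, exists f : 'rV[K]_n, x = \sum_i (f 0 i)%:A *: b i) -> kfree b ->
  has_kdim L n.
Proof.
move=> gen fr; exists b => x; have [f fE] := gen x; exists f; split=> // g gE.
apply/eqP; rewrite -subr_eq0; apply/eqP; apply: fr.
rewrite -[RHS](subrr x) {1}fE gE -sumrB; apply: eq_bigr => i _.
by rewrite !mxE -scalerBl -scalerBl.
Qed.

Lemma has_kdim_kfree n : has_kdim L n -> exists b : 'I_n -> L, kfree b.
Proof.
move=> [b hb]; exists b => f f0; have [g [_ gu]] := hb 0.
rewrite -(gu f) // -(gu 0) // big1 // => i _.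
by rewrite mxE scale0r scale0r.
Qed.

Lemma kdim_Some n : has_kdim L n -> kdim L = Some n.
Proof.
move=> hn; rewrite /kdim asboolT; last by exists n.
congr Some; apply: xget_unique => // m hm.
have [b fb] := has_kdim_kfree hn; have [c fc] := has_kdim_kfree hm.
by apply/eqP; rewrite eqn_leq (kfree_leq_kdim hn fc) (kfree_leq_kdim hm fb).
Qed.

End Dimension.

Section HighestWeight.
Variables (K : fieldType) (R : comAlgType K) (sigma sigmaV : R -> R).
Variables (h : R) (xi : K) (A : algType K) (iota : {lrmorphism R -> A}).
Variables (Xp Xm : A).
Hypothesis hA : is_ambiskew sigma sigmaV h xi iota Xp Xm.
Variables (L : lmodType A) (chi : nat -> R -> K) (c : nat -> K) (v : nat -> L).
Hypothesis chi_neq : forall i j, (i < j)%N -> exists a, chi i a != chi j a.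
Hypothesis v_weight : forall i a, iota a *: v i = (chi i a)%:A *: v i.
Hypothesis vS : forall i, Xm *: v i = v i.+1.
Hypothesis c0 : c 0 = 0.
Hypothesis Xp_v : forall i, Xp *: v i = (c i)%:A *: v i.-1.
Hypothesis v0 : v 0%N != 0.
Hypothesis L_simple : simple_module L.

(** Applying [iota a - psi n a] kills the last summand and multiplies another one by a scalar that
    is nonzero for a suitable [a]. The families are arbitrary because [v_eq0] needs one other than
    [v]. *)
Lemma weight_indep (psi : nat -> R -> K) (w : nat -> L) n :
  (forall i j, (i < j)%N -> exists a, psi i a != psi j a) ->
  (forall i a, iota a *: w i = (psi i a)%:A *: w i) ->
  \sum_(i < n) w i = 0 -> forall i, (i < n)%N -> w i = 0.
Proof.
move=> psi_neq; elim: n w => // n IH w hw s0.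
have small i : (i < n)%N -> w i = 0.
  move=> lt; have [a ne] := psi_neq _ _ lt.
  apply: (scalar_eq0 (k := psi i a - psi n a)); first by rewrite subr_eq0.
  apply: (IH (fun k => (psi k a - psi n a)%:A *: w k)) lt => [k b|].
    by rewrite -scalarC hw scalarC.
  have := congr1 (fun x => iota a *: x - (psi n a)%:A *: x) s0.
  rewrite !scaler0 subrr => e; rewrite -[RHS]e !scaler_sumr -sumrB big_ord_recr /=.
  rewrite [X in _ + X](_ : _ = 0); last by rewrite hw subrr.
  by rewrite addr0; apply: eq_bigr => k _; rewrite hw !scalerBl.
move=> i; rewrite ltnS leq_eqVlt => /predU1P[->|]; last exact: small.
move: s0; rewrite big_ord_recr /= big1 ?add0r // => k _; exact: small.
Qed.

(* Coefficients are kept in a polynomial, which makes their support finite. *)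
Definition wsum (n : nat) (p : {poly K}) : L :=
  \sum_(i < size p) (p`_i)%:A *: v (n + i).

Lemma wsum_leq n (p : {poly K}) M : (size p <= M)%N ->
  wsum n p = \sum_(i < M) (p`_i)%:A *: v (n + i).
Proof.
move=> le; rewrite /wsum (big_ord_widen M (fun i => (p`_i)%:A *: v (n + i))) //.
rewrite big_mkcond; apply: eq_bigr => i _; case: ltnP => // le'.
by rewrite nth_default // !scale0r.
Qed.

Lemma wsumD n p q : wsum n (p + q) = wsum n p + wsum n q.
Proof.
rewrite (wsum_leq n (size_polyD p q)) (wsum_leq n (leq_maxl (size p) (size q))).
rewrite (wsum_leq n (leq_maxr (size p) (size q))) -big_split /=.
by apply: eq_bigr => i _; rewrite coefD !scalerDl.
Qed.

Lemma wsumZ n k p : wsum n (k *: p) = k%:A *: wsum n p.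
Proof.
rewrite (wsum_leq n (size_scale_leq k p)) /wsum scaler_sumr.
by apply: eq_bigr => i _; rewrite coefZ scalarA.
Qed.

Lemma wsumXn n i : wsum n 'X^i = v (n + i).
Proof.
rewrite /wsum size_polyXn big_ord_recr /= coefXn eqxx !scale1r big1 ?add0r //.
by move=> k _; rewrite coefXn ltn_eqF ?ltn_ord // !scale0r.
Qed.

Definition tail_span (n : nat) : {pred L} := fun x => `[< exists p, x = wsum n p >].

Lemma tail_spanP n x : x \in tail_span n <-> exists p, x = wsum n p.
Proof. by split=> /asboolP. Qed.

Lemma tail_span_v n i : (n <= i)%N -> v i \in tail_span n.
Proof. by move=> le; apply/tail_spanP; exists 'X^(i - n); rewrite wsumXn subnKC. Qed.

Lemma tail_spanD n x y :
  x \in tail_span n -> y \in tail_span n -> x + y \in tail_span n.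
Proof.
move=> /tail_spanP[p ->] /tail_spanP[q ->]; apply/tail_spanP.
by exists (p + q); rewrite wsumD.
Qed.

Lemma tail_spanZ n k x : x \in tail_span n -> k%:A *: x \in tail_span n.
Proof.
by move=> /tail_spanP[p ->]; apply/tail_spanP; exists (k *: p); rewrite wsumZ.
Qed.

Lemma tail_span0 n : 0 \in tail_span n.
Proof. by apply/tail_spanP; exists 0; rewrite /wsum size_poly0 big_ord0. Qed.

(** The elements of [A] preserving the span form a subalgebra. It contains [Xp] because [c n = 0]
    keeps [Xp *: v n] from reaching [v n.-1]. *)
Lemma tail_span_submod n : c n = 0 -> GRing.submod_closed (tail_span n).
Proof.
move=> cn0; split=> [|a x y xS yS]; first exact: tail_span0.
apply: tail_spanD => //; move: x xS {y yS}.
pose P : {pred A} :=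
  fun a => `[< forall x, x \in tail_span n -> a *: x \in tail_span n >].
suff /asboolP : a \in P by [].
have gen b : (forall i, (n <= i)%N -> b *: v i \in tail_span n) -> b \in P.
  move=> hb; apply/asboolP => x /tail_spanP[p ->]; rewrite /wsum scaler_sumr.
  apply: (big_ind (fun x => x \in tail_span n)) => [||i _].
  - exact: tail_span0.
  - by move=> *; exact: tail_spanD.
  - by rewrite -scalarC; apply: tail_spanZ; apply: hb; exact: leq_addr.
apply: (ambiskew_ind hA) a => [|a||].
- split=> [|k a b /asboolP ha /asboolP hb|a b /asboolP ha /asboolP hb];
    apply/asboolP => x xS.
  + by rewrite scale1r.
  + rewrite scalerDl -mulr_algl -scalerA; apply: tail_spanD (hb _ xS).
    by apply: tail_spanZ; exact: ha.
  + by rewrite -scalerA; apply: ha; exact: hb.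
- by apply: gen => i le; rewrite v_weight; apply: tail_spanZ; exact: tail_span_v.
- apply: gen => i; rewrite Xp_v leq_eqVlt => /predU1P[<-|lt].
    by rewrite cn0 !scale0r; exact: tail_span0.
  by apply: tail_spanZ; apply: tail_span_v; rewrite -ltnS (ltn_predK lt).
- by apply: gen => i le; rewrite vS; apply: tail_span_v; exact: leqW.
Qed.

Lemma tail_span_full x : x \in tail_span 0.
Proof.
have [_ /(_ _ (tail_span_submod c0))[] //] := L_simple.
by move/(_ _ (tail_span_v (leqnn 0))) => e; move: v0; rewrite e eqxx.
Qed.

(** By simplicity the span of the [v i] with [n <= i] is zero or everything; in the latter case it
    would contain [v 0], whose weight is different. *)
Lemma v_eq0 n : (0 < n)%N -> c n = 0 -> forall i, (n <= i)%N -> v i = 0.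
Proof.
move=> n0 cn0; have [_ /(_ _ (tail_span_submod cn0))[z i le|full]] := L_simple.
  by apply: z; exact: tail_span_v.
have /tail_spanP[p vp] := full (v 0%N).
(* The family consists of [v 0] and the opposites of the terms of its expansion: it sums to zero,
   and the weights are distinct because [0 < n]. *)
pose psi i := if i is k.+1 then chi (n + k) else chi 0%N.
pose w i : L := if i is k.+1 then (- p`_k)%:A *: v (n + k) else v 0%N.
have : w 0%N = 0.
  apply: (@weight_indep psi w (size p).+1) => //.
  - case=> [|i] [|j] //= lt; apply: chi_neq; last by rewrite ltn_add2l.
    by rewrite addn_gt0 n0.
  - by case=> [|i] a /=; rewrite ?v_weight // -scalarC v_weight scalarC.
  rewrite big_ord_recl /= {1}vp /wsum -big_split big1 //= => i _.
  by rewrite -scalerDl -scalerDl subrr !scale0r.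
by move/eqP; rewrite /= (negPf v0).
Qed.

Lemma v_neq0 n : (forall k, (0 < k <= n)%N -> c k != 0) -> v n != 0.
Proof.
elim: n => // n IH hc; apply/eqP => vn0; have := Xp_v n.+1.
rewrite vn0 scaler0 => /esym/(scalar_eq0 (hc n.+1 _)).
rewrite ltnS leqnn => /(_ isT)/eqP.
by rewrite (negPf (IH _)) // => k /andP[k0 kn]; apply: hc; rewrite k0 leqW.
Qed.

Lemma v_kfree n : (forall k, (0 < k < n)%N -> c k != 0) ->
  kfree (fun i : 'I_n => v i).
Proof.
move=> hc f f0; apply/rowP => i; rewrite mxE; apply/eqP/negPn/negP => fi.
pose F k := if insub k is Some j then f 0 j else 0.
have FE (j : 'I_n) : F j = f 0 j by rewrite /F valK.
have /(_ i (ltn_ord i)) : forall k, (k < n)%N -> (F k)%:A *: v k = 0.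
  apply: (@weight_indep chi) => //.
    by move=> k a; rewrite -scalarC v_weight scalarC.
  by rewrite -[RHS]f0; apply: eq_bigr => j _; rewrite FE.
rewrite FE => /(scalar_eq0 fi)/eqP; apply/negP; apply: v_neq0 => k /andP[k0 kn].
by apply: hc; rewrite k0 (leq_ltn_trans kn).
Qed.

Lemma kdim_highest_weight n : (0 < n)%N -> c n = 0 ->
  (forall k, (0 < k < n)%N -> c k != 0) -> kdim L = Some n.
Proof.
move=> n0 cn0 hc; apply/kdim_Some/has_kdim_free; last exact: v_kfree.
move=> x; have /tail_spanP[p ->] := tail_span_full x.
exists (\row_(i < n) p`_i); rewrite (wsum_leq _ (leq_maxl (size p) n)).
rewrite [RHS](eq_bigr (fun i : 'I_n => (p`_i)%:A *: v i)); last first.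
  by move=> i _; rewrite mxE.
rewrite [RHS](big_ord_widen (maxn (size p) n) (fun i => (p`_i)%:A *: v i));
  last exact: leq_maxr.
rewrite [RHS]big_mkcond; apply: eq_bigr => i _; rewrite add0n; case: ltnP => // le.
by rewrite (v_eq0 n0 cn0 le) scaler0.
Qed.

Lemma kdim_highest_weight_infty :
  (forall k, (0 < k)%N -> c k != 0) -> kdim L = None.
Proof.
move=> hc; rewrite /kdim asboolF // => -[n hn].
have /(kfree_leq_kdim hn) : kfree (fun i : 'I_n.+1 => v i).
  by apply: v_kfree => k /andP[k0 _]; exact: hc.
by rewrite ltnn.
Qed.

End HighestWeight.

(** * Verma modules and the theorem *)

Section RootOrder.
Variables (K : fieldType) (q : K).

Lemma Nord_Some N : Nord q = Some N -> q ^+ 2 != 1 /\ N.-primitive_root q.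
Proof.
rewrite /Nord; case: ifP => // /andP[q2 /asboolP ex] [<-]; split=> //.
exact: (xgetPex 0%N ex).
Qed.

Lemma no_root_below_Nord n : olt (Some n) (Nord q) -> no_root_below q n.
Proof.
case E: (Nord q) => [N|] /=; rewrite /olt /=.
  rewrite -ltnNge => nN; right=> d /andP[d0 dn]; have [_ pr] := Nord_Some E.
  rewrite -(prim_order_dvd pr) gtnNdvd //; exact: leq_ltn_trans dn nN.
move=> _; have [q2|q2] := eqVneq (q ^+ 2) 1; [by left | right=> d /andP[d0 _]].
move: E; rewrite /Nord q2 /=; case: asboolP => // nex _; apply/eqP => qd.
by have [m pm _] := prim_order_exists d0 qd; apply: nex; exists m.
Qed.

End RootOrder.

Section VermaQuotient.
Variables (K : closedFieldType) (R : comAlgType K).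
Variables (sigma sigmaV : {lrmorphism R -> R}).
Hypotheses (sigmaK : cancel sigma sigmaV) (sigmaVK : cancel sigmaV sigma).
Variables (h : R) (xi : K) (A : algType K) (iota : {lrmorphism R -> A}).
Variables (Xp Xm : A).
Hypothesis hA : is_ambiskew sigma sigmaV h xi iota Xp Xm.
Hypothesis tf : torsion_free sigma sigmaV.
Implicit Types chi : {lrmorphism R -> K^o}.

(** Were the two characters equal, [sigma^(j-i)] would fix the kernel of [chi sigma^i]. *)
Lemma torsion_free_weights chi i j : (i < j)%N ->
  exists a, chi (iter i sigma a) != chi (iter j sigma a).
Proof.
move=> lt; apply: contrapT => nex.
have e a : chi (iter i sigma a) = chi (iter j sigma a).
  by apply/eqP; apply: contrapT => /negP ne; apply: nex; exists a.
pose psi : {lrmorphism R -> K^o} := chi \o iter_morphism sigma i.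
pose f := iter_morphism sigma (j - i); pose g := iter_morphism sigmaV (j - i).
have fg : cancel f g by exact: iter_morphismK.
have gf : cancel g f by exact: iter_morphismK.
have d0 : Posz (j - i) != 0 by rewrite -lt0n subn_gt0.
apply: (tf d0 (kernel_maximal psi)).
have -> : zpow sigma sigmaV (Posz (j - i)) @` kernel psi = f @` kernel psi.
  by congr (_ @` _); apply/funext => a; rewrite -zpow_morphismE.
rewrite (kernel_img psi fg gf); apply/funext => a; congr (_ = 0).
rewrite /psi /= !iter_morphismE e -[X in iter X](subnKC (ltnW lt)) iterD.
by congr (chi (iter i _ _)); have := gf a; rewrite /f /g !iter_morphismE.
Qed.

(* [X_+ X_-^k v = sing_coef k X_-^(k-1) v] for the generator [v] of the Verma
   module of weight [chi]. *)
Fixpoint sing_coef chi (k : nat) : K :=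
  if k is k'.+1 then chi (iter k' sigma h) + xi * sing_coef chi k' else 0.

Section Quotient.
Local Open Scope quotient_scope.
Variables (chi : {lrmorphism R -> K^o}) (L : lmodType A).
Hypothesis hL : simple_quotient (verma iota Xp (kernel chi)) L.

(** The image of the class of 1 is nonzero because it generates [L]. *)
Lemma simple_quotient_generator : exists v : L, [/\ v != 0, Xp *: v = 0 &
  forall a, iota a *: v = (chi a : K)%:A *: v].
Proof.
have [[[y y0] _] [pi pi_surj]] := hL.
pose V := verma iota Xp (kernel chi).
pose cl (a : A^o) : V := \pi_(quotmod (verma_ideal_closed iota Xp (kernel chi))) a.
have clE (a b : A^o) : a *: cl b = cl (a *: b) by exact: qscale_pi.
have cl_eq (a b : A^o) : verma_ideal iota Xp (kernel chi) (a - b) -> cl a = cl b.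
  by move=> e; apply/qpi_eq.
exists (pi (cl 1)); split=> [||a].
- apply: contra_neq y0 => v0; have [x <-] := pi_surj y.
  have -> : x = (repr x : A) *: cl 1 by rewrite clE [_ *: _]mulr1 /cl reprK.
  by rewrite linearZ /= v0 scaler0.
- rewrite -linearZ /= clE (cl_eq _ 0) => [|].
    have -> : cl 0 = 0 *: cl 1 by rewrite clE scale0r.
    by rewrite scale0r linear0.
  apply/asboolP; exists 1, [::]; split=> //.
  by rewrite big_nil addr0 subr0 mul1r [_ *: _]mulr1.
rewrite -!linearZ /= !clE; congr (pi _); apply: cl_eq; apply/asboolP.
exists 0, [:: (1, a - (chi a : K)%:A)]; split=> [p|].
  by rewrite inE => /eqP ->; exact: sub_character_in_kernel.
rewrite big_seq1 mul0r add0r mul1r rmorphB /= rmorph_alg.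
by rewrite ![_ *: (1 : A^o)]mulr1.
Qed.

Lemma kdim_spec :
  (exists n, [/\ (0 < n)%N, sing_coef chi n = 0,
     forall k, (0 < k < n)%N -> sing_coef chi k != 0 & kdim L = Some n]) \/
  ((forall k, (0 < k)%N -> sing_coef chi k != 0) /\ kdim L = None).
Proof.
have [rp rm rpm] := ambiskew_rels hA; have [Ls _] := hL.
have [v0 [v0_neq0 Xp0 v0w]] := simple_quotient_generator.
pose v k := (Xm ^+ k) *: v0; pose w k a : K := chi (iter k sigma a).
have vS k : Xm *: v k = v k.+1 by rewrite scalerA -exprS.
have vw k a : iota a *: v k = (w k a)%:A *: v k.
  elim: k a => [|k IH] a; first by rewrite /v expr0 scale1r v0w.
  rewrite -vS scalarC /w iterSr -IH !scalerA rm sigmaK.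
  by [].
have Xpv k : Xp *: v k = (sing_coef chi k)%:A *: v k.-1.
  elim: k => [|k IH]; first by rewrite /v expr0 !scale1r Xp0 !scale0r.
  rewrite -vS scalerA rpm scalerDl vw -[xi *: _]mulr_algl -!scalerA IH -scalarC /=.
  (* At [k = 0] the predecessor is truncated, so [Xm] does not bring [v k.-1] back to [v k]; the
     coefficient is zero there. *)
  case: k {IH} => [|k]; first by rewrite !scale0r !scaler0 mulr0 !addr0.
  by rewrite vS scalarA -scalerDl -scalerDl.
have wneq i j : (i < j)%N -> exists a, w i a != w j a by exact: torsion_free_weights.
have v00 : v 0%N != 0 by rewrite /v expr0 scale1r.
have [ex|nex] := pselect (exists n, (0 < n)%N && (sing_coef chi n == 0)).
  left; case: (ex_minnP ex) => n /andP[n0 /eqP cn0] nmin; exists n.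
  have cmin k : (0 < k < n)%N -> sing_coef chi k != 0.
    by move=> /andP[k0 kn]; apply: contraL kn => ck; rewrite -leqNgt nmin // k0.
  by split=> //; apply: (kdim_highest_weight hA wneq vw vS _ Xpv v00 Ls n0 cn0 cmin).
have cmin k : (0 < k)%N -> sing_coef chi k != 0.
  by move=> k0; apply: contra_notN nex => ck; exists k; rewrite k0.
by right; split=> //; apply: (kdim_highest_weight_infty wneq vw Xpv v00 cmin).
Qed.

End Quotient.

Section Compare.
Variables (chi chi' : {lrmorphism R -> K^o}) (L L' : lmodType A).
Hypothesis hL : simple_quotient (verma iota Xp (kernel chi)) L.
Hypothesis hL' : simple_quotient (verma iota Xp (kernel chi')) L'.

Lemma kdim_congr :
  (forall n, sing_coef chi n = 0 <-> sing_coef chi' n = 0) -> kdim L = kdim L'.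
Proof.
move=> e.
have [[n [n0 cn cmin ->]]|[cn ->]] := kdim_spec hL;
  have [[n' [n0' cn' cmin' ->]]|[cn' ->]] := kdim_spec hL' => //.
- congr Some; case: (ltngtP n n') => // lt.
    by have := cmin' n; rewrite n0 lt (proj1 (e n) cn) eqxx => /(_ isT).
  by have := cmin n'; rewrite n0' lt (proj2 (e n') cn') eqxx => /(_ isT).
- by have := cn' n n0; rewrite (proj1 (e n) cn) eqxx.
- by have := cn n' n0'; rewrite (proj2 (e n') cn') eqxx.
Qed.

End Compare.

(** [sing_coef] is linear in the values of [chi] at the [iter i sigma h], and the hypothesis for
    [chi sigma^i] multiplies each of them by the same [u]. *)
Lemma sing_coef_shift chi M (u : K) :
  (forall psi : {lrmorphism R -> K^o}, psi (iter M sigma h) = u * psi h) ->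
  forall n, sing_coef (chi \o iter_morphism sigma M) n = u * sing_coef chi n.
Proof.
move=> hu; elim=> [|n IH]; first by rewrite mulr0.
rewrite /= IH iter_morphismE mulrDr mulrCA; congr (_ + _).
rewrite -iterD addnC iterD -iter_morphismE.
have := hu (chi \o iter_morphism sigma n).
by rewrite /= !iter_morphismE.
Qed.

(** The power of [xi] turns the recursion of [sing_coef] into a plain sum. *)
Definition norm_weight chi (i : nat) : K := xi ^- i * chi (iter i sigma h).

Lemma sing_coefE chi n : xi != 0 ->
  sing_coef chi n.+1 = xi ^+ n * \sum_(i < n.+1) norm_weight chi i.
Proof.
move=> xi0; elim: n => [|n IH].
  by rewrite big_ord1 /norm_weight /= mulr0 addr0 expr0 invr1 !mul1r.
rewrite big_ord_recr -[LHS]/(chi (iter n.+1 sigma h) + xi * sing_coef chi n.+1) IH.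
rewrite mulrDr {2}/norm_weight mulVKf ?expf_neq0 // exprS -mulrA addrC.
by [].
Qed.

Lemma sing_coef_eq0 chi n : xi != 0 ->
  sing_coef chi n.+1 = 0 <-> \sum_(i < n.+1) norm_weight chi i = 0.
Proof.
move=> xi0; rewrite sing_coefE //; split=> [/eqP|->]; last by rewrite mulr0.
by rewrite mulf_eq0 expf_eq0 (negPf xi0) andbF => /eqP.
Qed.

End VermaQuotient.

Theorem lemma6p16 (K : closedFieldType) (charK : [pchar K] =i pred0)
  (R : comAlgType K) (fgR : finitely_generated R) (H : hopf_algebra R)
  (sigma sigmaV : {lrmorphism R -> R})
  (sigmaK : cancel sigma sigmaV) (sigmaVK : cancel sigmaV sigma)
  (h : R) (xi : K) (xi_neq0 : xi != 0)
  (A : algType K) (iota : {lrmorphism R -> A}) (Xp Xm : A)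
  (hA : is_ambiskew sigma sigmaV h xi iota Xp Xm)
  (rp rm lp lm sp sm : R)
  (hH : hopf_conditions H sigma sigmaV h xi rp rm lp lm sp sm)
  (tf : torsion_free sigma sigmaV)
  (L : set R -> lmodType A)
  (hL : forall m : set R, maximal_ideal m ->
    simple_quotient (verma iota Xp m) (L m))
  (h1 : ev (wint H sigma sigmaV 1) h != 0)
  (m : set R) (hm : maximal_ideal m) :
  let un := wint H sigma sigmaV in
  let G_half := Ghalf H sigma sigmaV h xi in
  let r1 := ev (un 1) (rp * rm) in
  let N := Nord (xi * r1) in
  let N' := Nord' (xi * r1) in
  [/\ (* a *)
      ole (kdim (L m)) N,
      (* b *)
      forall n : nat, kdim (L m) = Some n -> olt (Some n) N ->
        exists i j : nat, [/\ i = 1%N \/ i = 2%N, n = (2 * j + i)%N &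
          Gshift H (G_half i.-1) (un j) m],
      (* c *)
      forall i j : nat, i = 1%N \/ i = 2%N -> ole (Some (2 * j + i)%N) N ->
        G_half i.-1 m -> kdim (L (wadd H m (un j))) = Some (2 * j + i)%N
    & (* d *)
      forall p : nat, N' = Some p ->
        forall j : int, kdim (L (wadd H m (un (p%:Z * j)))) = kdim (L m)].
Proof.
have [chi mE] := maximal_ideal_character fgR hm; rewrite {m hm}mE.
move=> un G_half r1 N N'; set q := xi * r1 in N N' *.
have [q0 sh sl] := sigma_structure sigmaK sigmaVK xi_neq0 hH.
rewrite -/un -/r1 -/q in q0 sh sl.
(* The [beta] of the recursion depends on the weight through its value at [lam]; its nonvanishing
   uses the assumption on [h(1)]. *)
pose lam : R := lp * lm; rewrite -/lam in sh sl.
pose beta (psi : {lrmorphism R -> K^o}) : K := xi * ev (un 1) h * psi lam.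
have beta0 psi : beta psi != 0.
  by rewrite !mulf_neq0 //; exact: (character_lplm_neq0 hH).
pose gam := norm_weight sigma h xi; pose c := sing_coef sigma h xi.
have gamS psi i : gam psi i.+1 = q^-1 * gam psi i - beta psi * q ^+ i.
  have slam : iter i sigma lam = (xi * q) ^+ i *: lam.
    by elim: i => [|i /= ->]; rewrite ?scale1r // linearZ /= sl scalerA exprSr.
  have sih : iter i sigma (sigma h) =
      (xi / q) *: iter i sigma h - (xi ^+ 2 * ev (un 1) h) *: iter i sigma lam.
    by elim: i {slam} => [|i IH]; [exact: sh | rewrite /= IH linearB !linearZ].
  rewrite /gam /norm_weight iterSr sih slam linearB !linearZ /= /beta.
  set x : K := psi (iter i sigma h); set y : K := psi lam; set t := ev _ h.
  have scE (a b : K) : a *: (b : K^o) = a * b by [].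
  rewrite !scE exprS exprMn; have := expf_neq0 i xi_neq0; set z := xi ^+ i => z0.
  by field; rewrite q0 xi_neq0 z0.
have spec (psi : {lrmorphism R -> K^o}) :=
  kdim_spec sigmaK sigmaVK hA tf (hL _ (kernel_maximal psi)).
have c0P psi n : c psi n.+1 = 0 <-> \sum_(i < n.+1) gam psi i = 0.
  exact: sing_coef_eq0.
have c_geo psi n : no_root_below q n.+1 -> c psi n.+1 = 0 -> geo_rel (gam psi) n.
  move=> hn /c0P; exact: (sum_gam_geo_rel charK q0 (beta0 psi) (gamS psi)).
have geo_c psi n : geo_rel (gam psi) n -> c psi n.+1 = 0.
  by move/(geo_rel_sum_gam q0 (beta0 psi) (gamS psi)) => e; apply/c0P.
have ev_h (psi : {lrmorphism R -> K^o}) : ev (kernel psi) h = psi h.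
  exact: ev_kernel.
(* Subtracting the weight 1 composes with [sigma], so [G_(1/2)] is the condition
   [psi (sigma h) + xi * psi h = 0]. *)
have ev_half (psi : {lrmorphism R -> K^o}) :
    ev (wadd H (kernel psi) (wopp H (un 1))) h = psi (sigma h).
  by rewrite (wopp_wint1 sigmaK sigmaVK hH) (wadd_wint sigmaK sigmaVK hH) ev_kernel.
have wadd_nat (psi : {lrmorphism R -> K^o}) (j : nat) :
    wadd H (kernel psi) (un j) = kernel (psi \o iter_morphism sigmaV j).
  exact: (wadd_wint sigmaK sigmaVK hH).
have G_halfP (psi : {lrmorphism R -> K^o}) i j : i = 1%N \/ i = 2%N ->
    G_half i.-1 (kernel (psi \o iter_morphism sigma j)) <->
    geo_rel (gam psi) (2 * j + i.-1).
  have xij : xi ^- j != 0 by rewrite invr_neq0 // expf_neq0.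
  case=> ->; rewrite /G_half /Ghalf /geo_rel /= mul2n ?addn0 ?addn1 /= odd_double /=
    ?uphalf_double ?doubleK.
    rewrite ev_h /= iter_morphismE; split=> [[_ e]|/eqP e]; last first.
      split; [exact: kernel_maximal | apply/eqP; move: e].
      by rewrite mulf_eq0 (negPf xij).
    by rewrite /gam /norm_weight e mulr0.
  rewrite ev_half ev_h /= !iter_morphismE -iterSr.
  have gE : gam psi j + gam psi j.+1 =
      xi ^- j.+1 * ((psi (iter j.+1 sigma h) : K) + xi * psi (iter j sigma h)).
    rewrite /gam /norm_weight mulrDr addrC mulrA; congr (_ + _ * _).
    by rewrite exprS invfM mulrAC mulVf // mul1r.
  rewrite gE; split=> [[_ ->]|/eqP e]; first by rewrite mulr0.
  split; first exact: kernel_maximal.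
  by apply/eqP; move: e; rewrite mulf_eq0 invr_eq0 expf_eq0 (negPf xi_neq0) andbF.
split.
(* For a), [c] vanishes at [N], because [[N]_q = 0]. *)
- case E : N => [n|]; last by case: (kdim _).
  have [q2 pr] := Nord_Some E; have n0 := prim_order_gt0 pr.
  have cn : c chi n = 0.
    have := sum_gam_order q0 (gamS chi) n0 q2 (prim_expr_order pr).
    by case: {E pr} n n0 => // n _ /c0P.
  case: (spec chi) => [[k [k0 ck cmin ->]]|[cmin _]]; last first.
    by have := cmin n n0; rewrite -/c cn eqxx.
  rewrite /ole leqNgt; apply/negP => nk.
  by have := cmin n; rewrite n0 nk -/c cn eqxx => /(_ isT).
- move=> n dn nN.
  case: (spec chi) => [[k [k0 ck _ ek]]|[_ e]]; last by rewrite e in dn.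
  move: ek; rewrite dn => -[nk]; rewrite -{k}nk in k0 ck.
  case: n k0 ck dn nN => // s _ cs _ sN.
  have gs := c_geo _ _ (no_root_below_Nord sN) cs.
  (* The dimension is [s.+1], so [i - 1] and [j] are the parity and the half of [s]. *)
  exists (odd s).+1, s./2; split.
  + by case: (odd s); [right | left].
  + by rewrite addnS mul2n addnC odd_double_half.
  exists (kernel (chi \o iter_morphism sigma s./2)).
    apply/G_halfP; last by rewrite mul2n addnC odd_double_half.
    by case: (odd s); [right | left].
  rewrite wadd_nat; congr (kernel _); apply/funext => a /=.
  by rewrite (iter_morphismK _ sigmaVK).
- move=> i j hi leN hG; rewrite wadd_nat; set chi' := chi \o _.
  have ij : (2 * j + i = (2 * j + i.-1).+1)%N by case: hi => ->; rewrite -?addnS.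
  have gs : geo_rel (gam chi') (2 * j + i.-1).
    apply/G_halfP => //.
    suff -> : kernel (chi' \o iter_morphism sigma j) = kernel chi by [].
    by congr (kernel _); apply/funext => a /=; rewrite /chi' /= (iter_morphismK _ sigmaK).
  rewrite ij in leN *; move: (2 * j + i.-1)%N gs leN => s gs sN.
  (* The dimension [s.+1] may equal [N], so roots of unity are excluded only up to [s]. This
     suffices, as an earlier zero [c k.+1] has [k < s]. *)
  have lt_olt k : (k <= s)%N -> no_root_below q k.
    move=> ks; apply: no_root_below_Nord; move: sN; rewrite -/N; case: N => [n|] //=.
    by rewrite /olt /= -ltnNge; exact: leq_ltn_trans.
  have cs : c chi' s.+1 = 0 by exact: geo_c.
  have cmin k : (0 < k < s.+1)%N -> c chi' k != 0.
    case: k => // k /= ks'; have ks : (k < s)%N := ks'; apply/eqP => ck.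
    apply: (geo_rel_inj charK q0 (beta0 chi') (gamS chi') ks (lt_olt _ (leqnn s)) gs).
    exact: (c_geo chi' k (lt_olt _ ks) ck).
  case: (spec chi') => [[k [k0 ck kmin ->]]|[kmin _]]; last first.
    by have := kmin s.+1 isT; rewrite -/c cs eqxx.
  congr Some; case: (ltngtP k s.+1) => // lt.
    by have := cmin k; rewrite k0 lt /c ck eqxx => /(_ isT).
  by have := kmin s.+1; rewrite lt -/c cs eqxx => /(_ isT).
- move=> p Np j.
  have [q2 qp] : q ^+ 2 != 1 /\ q ^+ (2 * p) = 1.
    move: Np; rewrite /N' /Nord'; case E : (Nord q) => [n|] //= [<-].
    have [q2 pr] := Nord_Some E; split=> //.
    have := prim_expr_order pr; case: ifP => on qn.
      by rewrite mulnC exprM qn expr1n.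
    by rewrite mul2n -[n]odd_double_half on add0n doubleK in qn *.
  (* [gam_half_order] at [p], rewritten in terms of [psi (iter p sigma h)]. *)
  pose u : K := xi ^+ p * q ^- p.
  have u0 : u != 0 by rewrite mulf_neq0 ?invr_neq0 ?expf_neq0.
  have hu1 (psi : {lrmorphism R -> K^o}) : psi (iter p sigma h) = u * psi h.
    have := gam_half_order q0 (gamS psi) q2 qp.
    rewrite /gam /norm_weight expr0 invr1 mul1r /u => e.
    by rewrite -mulrA -e mulVKf // expf_neq0.
  have hu M (psi : {lrmorphism R -> K^o}) :
      psi (iter (p * M) sigma h) = u ^+ M * psi h.
    elim: M => [|M IH]; first by rewrite muln0 mul1r.
    rewrite mulnS addnC iterD exprS -mulrA -IH -!iter_morphismE.
    have := hu1 (psi \o iter_morphism sigma (p * M)).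
    by rewrite -iter_morphismE.
  have shift M (psi : {lrmorphism R -> K^o}) :
      kdim (L (kernel (psi \o iter_morphism sigma (p * M)))) =
      kdim (L (kernel psi)).
    have hL' (phi : {lrmorphism R -> K^o}) := hL _ (kernel_maximal phi).
    apply: (kdim_congr sigmaK sigmaVK hA tf (hL' _) (hL' _)) => n.
    rewrite (sing_coef_shift _ _ (hu M)); split=> [/eqP|->]; last by rewrite mulr0.
    by rewrite mulf_eq0 expf_eq0 (negPf u0) andbF => /eqP.
  (* [shift] composes with nonnegative powers of [sigma], which subtract from the weight; for
     [j >= 0] it is therefore applied to the translated weight, to come back to [chi]. *)
  rewrite (wadd_wint sigmaK sigmaVK hH); case: j => M.
    rewrite -PoszM; apply: etrans (esym (shift M _)) _.
    congr (kdim (L (kernel _))); apply/funext => a /=.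
    by rewrite (iter_morphismK _ sigmaK).
  rewrite NegzE mulrN -PoszM -(shift M.+1 chi).
  congr (kdim (L (kernel _))); apply/funext => a /=; congr (chi _).
  by case: (p * M.+1)%N.
Qed.
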